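(* Let $n\ge2$, let $0\ne A\in sp(\mathbb{R}^{2n+2},\Omega')$ with $\Sigma_A=\{x\in\mathbb{R}^{2n+2}:\Omega'(x,Ax)=1\}$ non-empty, and let $(D,\omega,\nabla)$ be the symplectic manifold with Ricci-type connection obtained by the local reduction construction around a point $x_0\in\Sigma_A$. Then $(D,\omega,\nabla)$ is locally symmetric (i.e. the curvature tensor of $\nabla$ is parallel) if and only if $A$ satisfies $A^2=\lambda I$ for a constant $\lambda\in\mathbb{R}$.
   Context: $\Omega'$ is the standard symplectic structure on $\mathbb{R}^{2n+2}$ and $\dot\nabla$ the standard flat connection. Local reduction construction around $x_0\in\Sigma_A$: the vector field $x\mapsto Ax$ is tangent to $\Sigma_A$, nowhere zero there, with flow $\phi_t=\exp(tA)|_{\Sigma_A}$. Choose an open neighbourhood $U_{x_0}$ of $x_0$ in $\Sigma_A$, an open ball $D\subset\mathbb{R}^{2n}$ centred at $0$, an interval $I=(-\epsilon,\epsilon)$ and a diffeomorphism $\chi:D\times I\to U_{x_0}$ with $\chi(0,0)=x_0$ and $\chi(y,t)=\phi_t(\chi(y,0))$; let $\pi=p_1\circ\chi^{-1}:U_{x_0}\to D$. For $x\in\Sigma_A$ let $\mathcal{H}_x=\{v:\Omega'(v,x)=\Omega'(v,Ax)=0\}\subset T_x\Sigma_A$; $\pi_{*x}:\mathcal{H}_x\to T_{\pi(x)}D$ is an isomorphism, and $\bar X$ denotes the horizontal lift (section of $\mathcal{H}$) of a vector field $X$ on $D$. The reduced symplectic form and connection are $$\omega_{\pi(x)}(X,Y)=\Omega'(\bar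 X,\bar Y)_x,\qquad \overline{\nabla_XY}(x)=(\dot\nabla_{\bar X}\bar Y)(x)-\Omega'(A\bar X,\bar Y)\,x+\Omega'(\bar X,\bar Y)\,Ax .$$ The connection $\nabla$ is a symplectic connection of Ricci-type, i.e. it is torsion free, $\nabla\omega=0$, and its curvature $R$ and Ricci tensor $r(X,Y)=\operatorname{tr}[Z\mapsto R(X,Z)Y]$ satisfy $$\omega(R(X,Y)Z,T)=-\tfrac{1}{2(n+1)}\big[2\omega(X,Y)r(Z,T)+\omega(X,Z)r(Y,T)+\omega(X,T)r(Y,Z)-\omega(Y,Z)r(X,T)-\omega(Y,T)r(X,Z)\big].$$ *)

(* Defs.v *)
From HB Require Import structures.
From mathcomp Require Import all_boot all_order all_algebra.
From mathcomp Require Import all_classical all_reals all_analysis.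
Set Implicit Arguments.
Unset Strict Implicit.
Unset Printing Implicit Defensive.
Import Order.TTheory GRing.Theory Num.Theory.
Import numFieldNormedType.Exports.
Local Open Scope classical_set_scope.
Local Open Scope ring_scope.

(** * Smooth maps, defined on arbitrary subsets of finite-dimensional spaces *)

(* [V] and [W] are meant to be finite dimensional and [O] open: there, the
   directional derivatives of [f] being C^k for every direction is the same as
   [x |-> 'd f x] being C^k. *)
Fixpoint Ck (R : realType) (V W : normedModType R) (k : nat) (O : set V)
    (f : V -> W) : Prop :=
  match k with
  | 0%N => forall x, O x -> {for x, continuous f}
  | k'.+1 => (forall x, O x -> differentiable f x) /\
             (forall v, Ck k' O (fun x => 'd f x v))
  end.

(* [F] is a smooth extension to the open neighbourhood [O] of [x] of the germ
   at [x] of [f], which is only meaningful on [S]. *)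
Definition smooth_extension (R : realType) (V W : normedModType R) (S : set V)
    (f : V -> W) (x : V) (O : set V) (F : V -> W) : Prop :=
  [/\ open O, O x, forall k, Ck k O F & forall z, O z -> S z -> F z = f z].

(* Smoothness of a map on a subset of the ambient space that need not be open:
   for an embedded submanifold this is smoothness in the intrinsic sense. *)
Definition smooth_on (R : realType) (V W : normedModType R) (S : set V)
    (f : V -> W) : Prop :=
  forall x, S x -> exists O F, smooth_extension S f x O F.

(* The tangent map of [f : S -> W] at [x], applied to [v]; for [S] a
   submanifold, [f] smooth and [v] tangent to [S] at [x], the vector
   ['d F x v] does not depend on the extension [F]. *)
Definition tangent_map (R : realType) (V W : normedModType R) (S : set V)
    (f : V -> W) (x v : V) : W :=
  xget 0 [set w | exists O F, smooth_extension S f x O F /\ w = 'd F x v].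

Definition diffeomorphism (R : realType) (V W : normedModType R) (S : set V)
    (T : set W) (f : V -> W) (g : W -> V) : Prop :=
  [/\ smooth_on S f, smooth_on T g, f @` S = T & forall p, S p -> g (f p) = p].

(** * Connections on an open subset of R^m *)

(* Vector fields on [D], and connections acting on them, are total functions;
   only their values on [D] matter. *)
Definition vfield (R : realType) (m : nat) := 'cV[R]_m -> 'cV[R]_m.

Definition connection (R : realType) (m : nat) :=
  vfield R m -> vfield R m -> vfield R m.

Definition lie_bracket (R : realType) (m : nat) (X Y : vfield R m) :
    vfield R m :=
  fun y => 'd Y y (X y) - 'd X y (Y y).

Definition curvature (R : realType) (m : nat) (nabla : connection R m)
    (X Y Z : vfield R m) : vfield R m :=
  fun y => nabla X (nabla Y Z) y - nabla Y (nabla X Z) y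
           - nabla (lie_bracket X Y) Z y.

Definition cov_curvature (R : realType) (m : nat) (nabla : connection R m)
    (W X Y Z : vfield R m) : vfield R m :=
  fun y => nabla W (curvature nabla X Y Z) y
           - curvature nabla (nabla W X) Y Z y
           - curvature nabla X (nabla W Y) Z y
           - curvature nabla X Y (nabla W Z) y.

Definition locally_symmetric (R : realType) (m : nat) (D : set 'cV[R]_m)
    (nabla : connection R m) : Prop :=
  forall W X Y Z : vfield R m,
    smooth_on D W -> smooth_on D X -> smooth_on D Y -> smooth_on D Z ->
    forall y, D y -> cov_curvature nabla W X Y Z y = 0.

(** * The hypersurface Sigma_A and its local reduction *)

(* The library's [ball] on column vectors is the one of the sup norm. *)
Definition eball (R : realType) (m : nat) (r : R) : set 'cV[R]_m :=
  [set y | \sum_i y i 0 ^+ 2 < r ^+ 2].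

Definition mexp (R : realType) (m : nat) (M : 'M[R]_m) : 'M[R]_m :=
  limn (series (fun k : nat => (k`!%:R)^-1 *: M ^+ k)).

Definition Omega (R : realType) (m : nat) (x y : 'cV[R]_(m + m)) : R :=
  (x^T *m block_mx 0 1%:M (- 1%:M) 0 *m y) 0 0.

Definition in_sp (R : realType) (m : nat) (A : 'M[R]_(m + m)) : Prop :=
  forall x y, Omega (A *m x) y + Omega x (A *m y) = 0.

Definition Sigma (R : realType) (m : nat) (A : 'M[R]_(m + m)) :
    set 'cV[R]_(m + m) :=
  [set x | Omega x (A *m x) = 1].

Definition horizontal (R : realType) (m : nat) (A : 'M[R]_(m + m))
    (x : 'cV[R]_(m + m)) : set 'cV[R]_(m + m) :=
  [set v | Omega v x = 0 /\ Omega v (A *m x) = 0].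

(* [chi] is a diffeomorphism with inverse [psi] from [eball r] times
   ]-eps, eps[ onto the open neighbourhood [U] of [x0] in [Sigma A],
   straightening the flow of [x |-> A x]. *)
Record reduction_chart (R : realType) (n : nat)
    (A : 'M[R]_(n.+1 + n.+1)) (x0 : 'cV[R]_(n.+1 + n.+1))
    (U : set 'cV[R]_(n.+1 + n.+1)) (r eps : R)
    (chi : 'cV[R]_(n + n) * R -> 'cV[R]_(n.+1 + n.+1))
    (psi : 'cV[R]_(n.+1 + n.+1) -> 'cV[R]_(n + n) * R) : Prop :=
  ReductionChart {
    chart_radius : 0 < r;
    chart_time : 0 < eps;
    chart_open : exists O, open O /\ U = O `&` Sigma A;
    chart_mem : U x0;
    chart_diffeo :
      diffeomorphism (@eball R (n + n) r `*` `]- eps, eps[) U chi psi;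
    chart_origin : chi (0, 0) = x0;
    chart_flow : forall y t, eball r y -> t \in `]- eps, eps[ ->
      chi (y, t) = mexp (t *: A) *m chi (y, 0)
  }.

Definition chart_proj (R : realType) (n : nat)
    (psi : 'cV[R]_(n.+1 + n.+1) -> 'cV[R]_(n + n) * R) :
    'cV[R]_(n.+1 + n.+1) -> 'cV[R]_(n + n) :=
  fun x => (psi x).1.

(* On [U] the vector [v] exists and is unique, because the tangent map of the
   projection is an isomorphism from the horizontal space onto R^(2n). *)
Definition hlift (R : realType) (n : nat) (A : 'M[R]_(n.+1 + n.+1))
    (U : set 'cV[R]_(n.+1 + n.+1))
    (psi : 'cV[R]_(n.+1 + n.+1) -> 'cV[R]_(n + n) * R)
    (X : vfield R (n + n)) : 'cV[R]_(n.+1 + n.+1) -> 'cV[R]_(n.+1 + n.+1) :=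
  fun x => xget 0 [set v | horizontal A x v /\
    tangent_map U (chart_proj psi) x v = X (chart_proj psi x)].

Definition reduced_form (R : realType) (n : nat) (A : 'M[R]_(n.+1 + n.+1))
    (U : set 'cV[R]_(n.+1 + n.+1)) (D : set 'cV[R]_(n + n))
    (psi : 'cV[R]_(n.+1 + n.+1) -> 'cV[R]_(n + n) * R)
    (omega : 'cV[R]_(n + n) -> 'cV[R]_(n + n) -> 'cV[R]_(n + n) -> R) : Prop :=
  forall X Y : vfield R (n + n), smooth_on D X -> smooth_on D Y ->
  forall x, U x ->
    let p := chart_proj psi x in
    omega p (X p) (Y p) = Omega (hlift A U psi X x) (hlift A U psi Y x).

(* The lift formula at every [x] in [U] determines [nabla X Y] on [D]; that it
   be again smooth is part of the typing of a connection. *)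
Definition reduced_connection (R : realType) (n : nat)
    (A : 'M[R]_(n.+1 + n.+1)) (U : set 'cV[R]_(n.+1 + n.+1))
    (D : set 'cV[R]_(n + n))
    (psi : 'cV[R]_(n.+1 + n.+1) -> 'cV[R]_(n + n) * R)
    (nabla : connection R (n + n)) : Prop :=
  forall X Y : vfield R (n + n), smooth_on D X -> smooth_on D Y ->
    smooth_on D (nabla X Y) /\
    forall x, U x ->
      let Xh := hlift A U psi X in
      let Yh := hlift A U psi Y in
      hlift A U psi (nabla X Y) x =
        tangent_map U Yh x (Xh x)
        - Omega (A *m Xh x) (Yh x) *: x
        + Omega (Xh x) (Yh x) *: (A *m x).

(* Main.v *)
Require Import Defs.
From HB Require Import structures.
From mathcomp Require Import all_boot all_order all_algebra.
From mathcomp Require Import all_classical all_reals all_analysis.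
From mathcomp Require Import ring lra.
Set Implicit Arguments.
Unset Strict Implicit.
Unset Printing Implicit Defensive.
Import Order.TTheory GRing.Theory Num.Theory.
Import numFieldNormedType.Exports.
Local Open Scope classical_set_scope.
Local Open Scope ring_scope.

(** Everything on [eball r] can be read on the slice [s y = chi (y, 0)], because
    the flow of [A] preserves [Omega], the horizontal spaces and the horizontal
    lifts.  A tangent vector [w] at [y] has the lift
    [h w = ds w + theta w *: A s] with [theta w = Omega (ds w) s], and the lift
    at [chi (y, t)] is its image under [exp (t A)] (hlift_chi).  A field along
    [U] that is equivariant under the flow is therefore the same thing as a
    vector-valued function [F] on the ball, and differentiating it along the
    lift of [X] becomes the covariant derivative
    [D_X F = dF X + theta X *: A F].  It preserves [Omega], commutes with [A],
    sends [s] to [h X], and, second derivatives being symmetric, its curvature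
    is [-2 Omega (h X) (h Y) A] (cov_commutator).

    With [P] the projection onto the horizontal space along [s] and [A s], the
    reduced connection is [h (nabla X Y) = P (D_X (h Y))].  Differentiating twice
    and inserting the curvature of this derivative gives (lift_curvature)

      [h (R(X,Y)Z) = Omega(A hX, hZ) hY - Omega(A hY, hZ) hX
         + Omega(hY, hZ) PA hX - Omega(hX, hZ) PA hY - 2 Omega(hX, hY) PA hZ].

    Since [nabla] is compatible with [Omega], the derivative of [R] only involves
    that of the endomorphism [P A], which is
    [X |-> - Omega(hW, hX) u - Omega(u, hX) hW] with [u = P (A^2 s)]
    (is_pcov_rho, lift_cov_curvature).  So the curvature is parallel wherever
    [u = 0].  Conversely, taking [W] and [X] with lift [u] and [Z = Y], the
    derivative of [R] is [8 Omega(u, hY)^2 u]; as [Omega] is nondegenerate on the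
    horizontal space, a parallel curvature forces [u = 0] (symmetric_accel_eq0).

    Finally [u = 0] along the slice says that [A^2 s] is a multiple of [s], hence,
    by the flow, that every point of [U] is an eigenvector of [A^2].  The cone
    over [U] is open in the ambient space, and a matrix having an open set of
    eigenvectors is scalar (eigen_scalar).  In the other direction, if [A^2] is
    scalar then [u] is the projection of a multiple of [s], which is [0].

    The analytic groundwork consists of the closure properties of C^k maps, the
    symmetry of second derivatives, and the termwise differentiation of the
    exponential series. *)

(** * Differentials and C^k maps between finite-dimensional spaces *)

Lemma scale_is_bilinear (R : realType) (W : normedModType R) :
  bilinear_for
    (GRing.Scale.Law.clone _ _ *:%R _) (GRing.Scale.Law.clone _ _ *:%R _)
    ( *:%R : R -> W -> W).
Proof.
split=> [u'|u] a x y /=.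
- by rewrite scalerDl scalerA.
- by rewrite scalerDr !scalerA mulrC.
Qed.

Lemma is_diff_scale (R : realType) (V W : normedModType R) (x : V)
    (k dk : V -> R) (f df : V -> W) :
  is_diff x k dk -> is_diff x f df ->
  is_diff x (fun y => k y *: f y) (fun v => k x *: df v + dk v *: f x).
Proof.
move=> kx fx.
pose BM := bilinear_isBilinear.Build R R W W _ _ ( *:%R : R -> W -> W)
  (@scale_is_bilinear R W).
pose B : {bilinear R -> W -> W} := HB.pack ( *:%R : R -> W -> W) BM.
have cB : continuous (fun p : R * W => B p.1 p.2).
  by move=> p; exact: scale_continuous.
have dB : is_diff (k x, f x) (fun p => B p.1 p.2)
    (fun p => B (k x) p.2 + B p.1 (f x)).
  by apply: DiffDef; [exact: differentiable_bilin|rewrite diff_bilin].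
have H := is_diff_comp (is_diff_pair kx fx) dB.
exact: (is_diff_eq H).
Qed.

Lemma is_diff_add (R : realType) (V W : normedModType R) (x : V)
    (f df g dg : V -> W) :
  is_diff x f df -> is_diff x g dg ->
  is_diff x (fun y => f y + g y) (fun v => df v + dg v).
Proof. by move=> fx gx; exact: (is_diffD fx gx). Qed.

Lemma diff_valE (R : realType) (V W : normedModType R) (x v : V)
    (f df : V -> W) :
  is_diff x f df -> 'd f x v = df v.
Proof. by move=> [_ ->]. Qed.

(** The differential depends only on the germ: this is what allows smooth
    extensions to be exchanged for the maps that they extend. *)
Lemma near_eq_is_diff (R : realType) (V W : normedModType R) (x : V)
    (f g df : V -> W) :
  {near x, f =1 g} -> is_diff x f df -> is_diff x g df.
Proof.
move=> fg [dfx <-].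
have gx : g x = f x by rewrite (nbhs_singleton fg).
have eg : g \o shift x = cst (g x) + 'd f x +o_ 0 id.
  apply/eqaddoE/eqaddoP => _ /posnumP[e].
  have /eqaddoP/(_ e%:num ltac:(by [])) H := diff_locally dfx.
  have {}fg : \forall z \near 0, f (z + x) = g (z + x).
    have zx : (z + x) @[z --> (0 : V)] --> x.
      rewrite -[X in _ --> X]add0r; apply: cvgD; [exact: cvg_id|exact: cvg_cst].
    exact: zx fg.
  near=> z.
  have -> : (g \o shift x - (cst (g x) + 'd f x)) z =
            (f \o shift x - (cst (f x) + 'd f x)) z.
    by rewrite /= -[LHS]/(g (z + x) - (g x + 'd f x z)) gx -(near fg z).
  by near: z.
have dE : 'd g x = 'd f x :> (V -> W).
  by apply: diff_unique => //; exact: diff_continuous.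
apply: DiffDef => //.
by apply/diff_locallyP; rewrite dE; split=> //; exact: diff_continuous.
Unshelve. all: by end_near. Qed.

(** Finite dimension, stated through a frame with continuous coordinates.  The
    coordinates turn the chain rule, where the direction of differentiation
    moves with the point, into finite sums of products of C^k functions. *)
Definition framed (R : realType) (W : normedModType R) :=
  exists (I : finType) (e : I -> W) (c : I -> {linear W -> R}),
    (forall i, continuous (c i)) /\ (forall w, w = \sum_i c i w *: e i).

Lemma framed_scalar (R : realType) : framed R.
Proof.
exists unit, (fun=> 1), (fun=> idfun); split=> [i|w].
  by move=> x; exact: cvg_id.
by rewrite big_const card_unit /= addr0 [RHS]mulr1.
Qed.

Lemma framed_prod (R : realType) (V W : normedModType R) :
  framed V -> framed W -> framed (V * W)%type.
Proof.
move=> [I [e [c [cc ce]]]] [J [f [d [dc df]]]].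
exists (I + J)%type, (fun s => match s with inl i => (e i, 0) | inr j => (0, f j) end).
exists (fun s => match s with
  | inl i => GRing.Linear.clone _ _ _ _ (c i \o fst) _
  | inr j => GRing.Linear.clone _ _ _ _ (d j \o snd) _
  end).
split.
  case=> i x; apply: continuous_comp.
  + exact: cvg_fst.
  + exact: cc.
  + exact: cvg_snd.
  + exact: dc.
move=> [v w]; rewrite big_sumType /=.
rewrite [v in LHS]ce [w in LHS]df.
have -> : \sum_i c i v *: (e i, 0 : W) = (\sum_i c i v *: e i, 0).
  elim/big_ind2 : _ => //.
    by move=> a b a' b' -> ->; rewrite /GRing.add /= /add_pair /= addr0.
  by move=> i _; rewrite /GRing.scale /= /scale_pair /= scaler0.
have -> : \sum_i d i w *: (0 : V, f i) = (0, \sum_i d i w *: f i).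
  elim/big_ind2 : _ => //.
    by move=> a b a' b' -> ->; rewrite /GRing.add /= /add_pair /= addr0.
  by move=> i _; rewrite /GRing.scale /= /scale_pair /= scaler0.
by rewrite /GRing.add /= /add_pair /= addr0 add0r.
Qed.

Lemma framed_cV (R : realType) m : framed 'cV[R]_m.
Proof.
pose c (i : 'I_m) : 'cV[R]_m -> R := fun v => v i 0.
have lc i : linear (c i) by move=> a u v; rewrite /c !mxE.
pose cM i := GRing.isLinear.Build _ _ _ _ _ (lc i).
pose cL i : {linear 'cV[R]_m -> R} := HB.pack (c i) (cM i).
exists 'I_m, (fun i => delta_mx i 0), cL; split=> [i|w].
  exact: coord_continuous.
rewrite [w in LHS]matrix_sum_delta; apply: eq_bigr => i _.
by rewrite big_ord1.
Qed.

Lemma framed_continuous (R : realType) (V W : normedModType R)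
  (L : {linear V -> W}) : framed V -> continuous L.
Proof.
move=> [I [e [c [cc ce]]]] x.
have -> : (L : V -> W) = fun v => \sum_i c i v *: L (e i).
  apply/funext => v; rewrite [v in LHS]ce linear_sum.
  by apply: eq_bigr => i _; rewrite linearZ.
elim: (index_enum I) => [|i s IHs].
  by under eq_fun do rewrite big_nil; exact: cvg_cst.
under eq_fun do rewrite big_cons; apply: cvgD IHs.
by apply: cvgZr_tmp; exact: cc.
Qed.

Lemma is_diff_sum (R : realType) (V W : normedModType R) (I : Type)
    (s : seq I) (x : V) (f df : I -> V -> W) :
  (forall i, is_diff x (f i) (df i)) ->
  is_diff x (fun y => \sum_(i <- s) f i y) (fun v => \sum_(i <- s) df i v).
Proof.
move=> fx; elim: s => [|i s IHs].
  under eq_fun do rewrite big_nil; under [X in is_diff _ _ X]eq_fun do rewrite big_nil.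
  exact: is_diff_cst.
under eq_fun do rewrite big_cons; under [X in is_diff _ _ X]eq_fun do rewrite big_cons.
exact: is_diffD.
Qed.

Lemma is_diff_lin (R : realType) (V W Z : normedModType R)
    (L : {linear W -> Z}) (x : V) (f df : V -> W) :
  continuous L -> is_diff x f df -> is_diff x (L \o f) (L \o df).
Proof.
move=> cL fx; apply: is_diff_comp.
by apply: DiffDef; [exact: linear_differentiable|rewrite diff_lin].
Qed.

Section Ck.
Context {R : realType}.
Implicit Types V W Z : normedModType R.

Lemma Ck_ext V W k (O : set V) (f g : V -> W) : open O ->
  (forall x, O x -> f x = g x) -> Ck k O f -> Ck k O g.
Proof.
move=> oO; elim: k f g => [|k IHk] f g fg.
  move=> Cf x Ox; have fx : f z @[z --> x] --> f x := Cf x Ox.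
  suff : g z @[z --> x] --> g x by [].
  rewrite -(fg x Ox).
  apply: cvg_trans fx; apply: near_eq_cvg.
  near=> z; apply: fg; near: z; exact: open_nbhs_nbhs.
move=> [df Cf].
have dg x : O x -> is_diff x g ('d f x).
  move=> Ox; apply: near_eq_is_diff (differentiableP (df x Ox)).
  near=> z; apply: fg; near: z; exact: open_nbhs_nbhs.
split=> [x Ox|v]; first by have [] := dg x Ox.
apply: IHk (Cf v) => x Ox.
by rewrite (diff_valE _ (dg x Ox)).
Unshelve. all: by end_near. Qed.

Lemma Ck_sub V W k (O O' : set V) (f : V -> W) :
  O' `<=` O -> Ck k O f -> Ck k O' f.
Proof.
move=> sO; elim: k f => [|k IHk] f /=; first by move=> Cf x /sO; exact: Cf.
by move=> [df Cf]; split=> [x /sO|v]; [exact: df|exact/IHk/Cf].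
Qed.

Lemma CkW V W k (O : set V) (f : V -> W) : Ck k.+1 O f -> Ck k O f.
Proof.
elim: k f => [|k IHk] f [df Cf].
  by move=> x Ox; exact/differentiable_continuous/df.
by split=> // v; exact/IHk/Cf.
Qed.

Lemma Ck_local V W k (S : set V) (f : V -> W) :
  (forall x, S x -> exists O, [/\ open O, O x & Ck k O f]) -> Ck k S f.
Proof.
elim: k f => [|k IHk] f H /=.
  by move=> x Sx; have [B [_ Ox Cf]] := H x Sx; exact: Cf.
split=> [x Sx|v]; first by have [B [_ Ox [df _]]] := H x Sx; exact: df.
by apply: IHk => x Sx; have [B [oO Ox [_ Cf]]] := H x Sx; exists B; split=> //; exact: Cf.
Qed.

Lemma Ck_cst V W k (O : set V) (w : W) : Ck k O (fun=> w).
Proof.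
elim: k w => [|k IHk] w /=; first by move=> x _; exact: cvg_cst.
split=> [x _|v]; first exact: differentiable_cst.
by rewrite (_ : (fun x : V => _) = (fun=> 0)) //; apply/funext => x; rewrite diff_cst.
Qed.

Lemma CkD V W k (O : set V) (f g : V -> W) : open O ->
  Ck k O f -> Ck k O g -> Ck k O (fun x => f x + g x).
Proof.
move=> oO; elim: k f g => [|k IHk] f g.
  by move=> Cf Cg x Ox; apply: cvgD; [exact: Cf|exact: Cg].
move=> [df Cf] [dg Cg]; split=> [x Ox|v].
  by apply: differentiableD; [exact: df|exact: dg].
apply: (Ck_ext oO) (IHk _ _ (Cf v) (Cg v)) => x Ox.
by rewrite (diff_valE _
  (is_diff_add (differentiableP (df x Ox)) (differentiableP (dg x Ox)))).
Qed.

Lemma Ck_sum V W k (O : set V) (I : Type) (s : seq I) (f : I -> V -> W) :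
  open O -> (forall i, Ck k O (f i)) -> Ck k O (fun x => \sum_(i <- s) f i x).
Proof.
move=> oO Cf; elim: s => [|i s IHs].
  by under eq_fun do rewrite big_nil; exact: Ck_cst.
by under eq_fun do rewrite big_cons; exact: CkD.
Qed.

Lemma CkZ V W k (O : set V) (c : V -> R) (f : V -> W) : open O ->
  Ck k O c -> Ck k O f -> Ck k O (fun x => c x *: f x).
Proof.
move=> oO; elim: k c f => [|k IHk] c f.
  by move=> Cc Cf x Ox; apply: cvgZ; [exact: Cc|exact: Cf].
move=> Cc1 Cf1; have [dc Cc] := Cc1; have [df Cf] := Cf1.
have H x (Ox : O x) := is_diff_scale (differentiableP (dc x Ox))
  (differentiableP (df x Ox)).
split=> [x Ox|v]; first by have [] := H x Ox.
apply: (@Ck_ext _ _ _ _ (fun x => c x *: 'd f x v + 'd c x v *: f x)) => //.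
  by move=> x Ox; rewrite (diff_valE _ (H x Ox)).
apply: (CkD oO).
  exact: (IHk c (fun x => 'd f x v) (CkW Cc1) (Cf v)).
exact: (IHk (fun x => 'd c x v) f (Cc v) (CkW Cf1)).
Qed.

Lemma Ck_lin V W Z k (O : set V) (L : {linear W -> Z}) (f : V -> W) :
  open O -> continuous L -> Ck k O f -> Ck k O (L \o f).
Proof.
move=> oO cL; elim: k f => [|k IHk] f.
  by move=> Cf x Ox; apply: continuous_comp; [exact: Cf|exact: cL].
move=> [df Cf].
have H x (Ox : O x) := is_diff_lin cL (differentiableP (df x Ox)).
split=> [x Ox|v]; first by have [] := H x Ox.
by apply: (Ck_ext oO) (IHk _ (Cf v)) => x Ox; rewrite (diff_valE _ (H x Ox)).
Qed.

(** In a frame [e] with coordinates [c], ['d f x (X x)] is the sum of the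
    [c i (X x) *: 'd f x (e i)], where now each direction is constant. *)
Lemma Ck_apply V W k (O : set V) (f : V -> W) (X : V -> V) : framed V ->
  open O -> Ck k.+1 O f -> Ck k O X -> Ck k O (fun x => 'd f x (X x)).
Proof.
move=> [I [e [c [cc ce]]]] oO [df Cf] CX.
rewrite (_ : (fun x => _) = fun x => \sum_i c i (X x) *: 'd f x (e i)).
  apply: (Ck_sum _ oO) => i; apply: (CkZ oO); last exact: Cf.
  exact: (Ck_lin oO (cc i) CX).
apply/funext => x; rewrite [X x in LHS]ce linear_sum.
by apply: eq_bigr => i _; rewrite linearZ.
Qed.

(** The same expansion, applied to ['d g (f x) ('d f x v)], puts the derivative
    of the composite in a form to which the induction hypothesis applies. *)
Lemma Ck_comp V W Z k (O : set V) (U : set W) (f : V -> W) (g : W -> Z) :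
  framed W -> open O -> (forall x, O x -> U (f x)) ->
  Ck k O f -> Ck k U g -> Ck k O (g \o f).
Proof.
move=> fW oO fU; have [I [e [c [cc ce]]]] := fW.
elim: k f g fU => [|k IHk] f g fU.
  by move=> Cf Cg x Ox; apply: continuous_comp; [exact: Cf|exact/Cg/fU].
move=> Cf1 [dg Cg]; have [df Cf] := Cf1.
split=> [x Ox|v].
  exact: (differentiable_comp (df x Ox) (dg _ (fU x Ox))).
apply: (@Ck_ext _ _ _ _ (fun x => \sum_i c i ('d f x v) *: 'd g (f x) (e i))) => //.
  move=> x Ox; rewrite (diff_comp (df x Ox) (dg _ (fU x Ox))).
  rewrite /= ['d f x v in RHS]ce linear_sum.
  by apply: eq_bigr => i _; rewrite linearZ.
apply: (Ck_sum _ oO) => i; apply: (CkZ oO).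
  exact: (Ck_lin oO (cc i) (Cf v)).
exact: (IHk f (fun y => 'd g y (e i)) fU (CkW Cf1) (Cg (e i))).
Qed.

Lemma CkB V W k (O : set V) (f g : V -> W) : open O ->
  Ck k O f -> Ck k O g -> Ck k O (fun x => f x - g x).
Proof.
move=> oO Cf Cg.
rewrite (_ : (fun x => _) = fun x => f x + (-1) *: g x); last first.
  by apply/funext => x; rewrite scaleN1r.
by apply: CkD => //; apply: CkZ => //; exact: Ck_cst.
Qed.

(** Taking the same [df] at every point makes [f] affine. *)
Lemma Ck_affine V W k (O : set V) (f df : V -> W) :
  (forall x, is_diff x f df) -> Ck k O f.
Proof.
move=> Df; case: k => [|k].
  by move=> x _; apply: differentiable_continuous; have [] := Df x.
split=> [x _|v]; first by have [] := Df x.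
rewrite (_ : (fun x => _) = fun=> df v); first exact: Ck_cst.
by apply/funext => x; rewrite (diff_valE _ (Df x)).
Qed.

Lemma is_diff_fst V W (p : V * W) : is_diff p (fst : V * W -> V) (fst : V * W -> V).
Proof.
pose L := GRing.Linear.clone _ _ _ _ (fst : V * W -> V) _.
apply: (@is_diff_lin _ _ _ _ L _ id id _ (is_diff_id p)) => q.
exact: cvg_fst.
Qed.

Lemma is_diff_snd V W (p : V * W) : is_diff p (snd : V * W -> W) (snd : V * W -> W).
Proof.
pose L := GRing.Linear.clone _ _ _ _ (snd : V * W -> W) _.
apply: (@is_diff_lin _ _ _ _ L _ id id _ (is_diff_id p)) => q.
exact: cvg_snd.
Qed.

Lemma Ck_fst V W W' k (O : set V) (F : V -> W * W') : open O ->
  Ck k O F -> Ck k O (fun z => (F z).1).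
Proof.
pose L := GRing.Linear.clone _ _ _ _ (fst : W * W' -> W) _.
move=> oO; apply: (@Ck_lin _ _ _ _ _ L) => // q.
exact: cvg_fst.
Qed.

Lemma Ck_snd V W W' k (O : set V) (F : V -> W * W') : open O ->
  Ck k O F -> Ck k O (fun z => (F z).2).
Proof.
pose L := GRing.Linear.clone _ _ _ _ (snd : W * W' -> W') _.
move=> oO; apply: (@Ck_lin _ _ _ _ _ L) => // q.
exact: cvg_snd.
Qed.

(** On an open set the extensions involved in smoothness agree near each point
    with the map itself, so that smoothness is the intrinsic notion. *)
Lemma smooth_on_open V W (S : set V) (f : V -> W) : open S ->
  smooth_on S f <-> forall k, Ck k S f.
Proof.
move=> oS; split=> [Sf k|Cf x Sx]; last by exists S, f; split.
apply: Ck_local => x Sx; have [B [F [oB Bx CF FE]]] := Sf x Sx.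
exists (B `&` S); split=> //; first exact: openI.
apply: (@Ck_ext _ _ _ _ F); first exact: openI.
  by move=> z [Bz Sz]; exact: FE.
by apply: Ck_sub (CF k) => z [].
Qed.

End Ck.

Section VectorValued.
Context {R : realType} (V : normedModType R).

Lemma is_diff_coord (q : nat) (i : 'I_q) (x : V) (f df : V -> 'cV[R]_q) :
  is_diff x f df -> is_diff x (fun z => f z i 0) (fun v => df v i 0).
Proof.
pose c : 'cV[R]_q -> R := fun v => v i 0.
have lc : linear c by move=> a u v; rewrite /c !mxE.
pose cM := GRing.isLinear.Build _ _ _ _ _ lc.
pose cL : {linear 'cV[R]_q -> R} := HB.pack c cM.
exact: (is_diff_lin (L := cL) (@coord_continuous _ _ _ i 0)).
Qed.

Lemma Ck_coord (q : nat) (i : 'I_q) k (O : set V) (f : V -> 'cV[R]_q) :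
  open O -> Ck k O f -> Ck k O (fun z => f z i 0).
Proof.
pose c : 'cV[R]_q -> R := fun v => v i 0.
have lc : linear c by move=> a u v; rewrite /c !mxE.
pose cM := GRing.isLinear.Build _ _ _ _ _ lc.
pose cL : {linear 'cV[R]_q -> R} := HB.pack c cM.
move=> oO; exact: (Ck_lin (L := cL) oO (@coord_continuous _ _ _ i 0)).
Qed.

Lemma is_diff_mulmx (q r : nat) (A : 'M[R]_(r, q)) (x : V) (f df : V -> 'cV[R]_q) :
  is_diff x f df -> is_diff x (fun z => A *m f z) (fun v => A *m df v).
Proof.
exact: (is_diff_lin (L := mulmx A : {linear 'cV[R]_q -> 'cV[R]_r})
  (framed_continuous (framed_cV R q))).
Qed.

Lemma Ck_mulmx (q r : nat) (A : 'M[R]_(r, q)) k (O : set V) (f : V -> 'cV[R]_q) :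
  open O -> Ck k O f -> Ck k O (fun z => A *m f z).
Proof.
move=> oO; exact: (Ck_lin (L := mulmx A : {linear 'cV[R]_q -> 'cV[R]_r}) oO
  (framed_continuous (framed_cV R q))).
Qed.

End VectorValued.

(** * Symmetry of second derivatives *)

Section Schwarz.
Context {R : realType}.
Implicit Types V W : normedModType R.

Lemma is_diff_line V (x u : V) (s : R) :
  is_diff s (fun s : R => x + s *: u) (fun t => t *: u).
Proof.
have H := is_diff_add (is_diff_cst x s) (is_diff_scale (is_diff_id s) (is_diff_cst u s)).
by apply: (is_diff_eq H); apply/funext => t; rewrite scaler0 !add0r.
Qed.

Lemma is_derive_diff V (s : R) (f df : R -> V) :
  is_diff s f df -> is_derive s 1 f (df 1).
Proof.
move=> [fs fE]; apply: DeriveDef; first exact: diff_derivable.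
by rewrite deriveE // fE.
Qed.

Lemma is_derive_line V W (f : V -> W) (x u : V) (s : R) :
  differentiable f (x + s *: u) ->
  is_derive s 1 (fun s => f (x + s *: u)) ('d f (x + s *: u) u).
Proof.
move=> df; have H := is_diff_comp (is_diff_line x u s) (differentiableP df).
by have := is_derive_diff H; rewrite /= scale1r.
Qed.

Lemma mvt_line V (f : V -> R) (x u : V) (h : R) : 0 < h ->
  (forall s, 0 <= s <= h -> differentiable f (x + s *: u)) ->
  exists2 s, 0 <= s <= h & f (x + h *: u) - f x = h * 'd f (x + s *: u) u.
Proof.
move=> h0 df; pose g s := f (x + s *: u); pose dg s := 'd f (x + s *: u) u.
have Dg s : 0 <= s <= h -> is_derive s 1 g (dg s).
  by move=> sh; exact/is_derive_line/df.
have [||s sh] := @MVT R g dg 0 h h0.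
- by move=> s /[!in_itv]/= /andP[s0 sh]; apply: Dg; rewrite !ltW.
- apply: derivable_within_continuous => s /[!in_itv]/= sh.
  by have [] := Dg s sh.
rewrite /g /dg scale0r addr0 subr0 => ->; exists s; last exact: mulrC.
by move: sh; rewrite in_itv/= => /andP[s0 sh]; rewrite !ltW.
Qed.

(** Two applications of the mean value theorem, first in the direction [u] to
    the increment of [f] along [v], then in the direction [v].  The left-hand
    side is symmetric in [u] and [v], which is the source of Schwarz's
    theorem. *)
Lemma second_difference V (f : V -> R) (O : set V) (x u v : V) (h : R) : 0 < h ->
  (forall s t, 0 <= s <= h -> 0 <= t <= h -> O (x + s *: u + t *: v)) ->
  Ck 2 O f ->
  exists s t, [/\ 0 <= s <= h, 0 <= t <= h &
    f (x + h *: u + h *: v) - f (x + h *: u) - f (x + h *: v) + f x =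
    h ^+ 2 * 'd (fun z => 'd f z u) (x + s *: u + t *: v) v].
Proof.
move=> h0 hO [df /(_ u) [ddf _]].
pose g z := f (z + h *: v) - f z.
have hh : 0 <= h <= h by rewrite ltW /=.
have h00 : 0 <= (0 : R) <= h by rewrite lexx ltW.
have Dg s : 0 <= s <= h -> is_diff (x + s *: u) g
    (fun w => 'd f (x + s *: u + h *: v) w - 'd f (x + s *: u) w).
  move=> sh.
  have d1 : is_diff (x + s *: u) (fun z => z + h *: v) id.
    have H := is_diff_add (is_diff_id (x + s *: u)) (is_diff_cst (h *: v) (x + s *: u)).
    by apply: (is_diff_eq H); apply/funext => t; rewrite addr0.
  have d2 := is_diff_comp d1 (differentiableP (df _ (hO s h sh hh))).
  have d3 : is_diff (x + s *: u) f ('d f (x + s *: u)).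
    by apply/differentiableP/df; have := hO s 0 sh h00; rewrite scale0r addr0.
  exact: (is_diffB d2 d3).
have [|s sh Hs] := @mvt_line V g x u h h0.
  by move=> s sh; have [] := Dg s sh.
have [|t th Ht] := @mvt_line V (fun z => 'd f z u) (x + s *: u) v h h0.
  by move=> t th; apply: ddf; exact: hO.
exists s, t; split=> //.
rewrite expr2 -mulrA -Ht -(diff_valE u (Dg s sh)) -Hs /g.
rewrite addrAC; ring.
Qed.

(** Exchanging [u] and [v] in the second difference equates the values of the
    two mixed derivatives at two points of a small parallelogram at [x]; both
    are continuous at [x]. *)
Lemma schwarz_real V (f : V -> R) (O : set V) (x u v : V) :
  open O -> O x -> Ck 2 O f ->
  'd (fun z => 'd f z u) x v = 'd (fun z => 'd f z v) x u.
Proof.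
move=> oO Ox Cf; have [_ Cf'] := Cf.
pose a z := 'd (fun z => 'd f z u) z v.
pose b z := 'd (fun z => 'd f z v) z u.
have ca : a z @[z --> x] --> a x by have [_ /(_ v)] := Cf' u; exact.
have cb : b z @[z --> x] --> b x by have [_ /(_ u)] := Cf' v; exact.
rewrite -/(a x) -/(b x); apply/eqP; rewrite -subr_eq0 -normr_le0.
apply/ler_addgt0Pr => e e0; rewrite add0r.
have e20 : 0 < e / 2 by rewrite divr_gt0.
have : \forall z \near x, [/\ O z, `|a x - a z| <= e / 2 & `|b x - b z| <= e / 2].
  near=> z; split; near: z.
  - exact: open_nbhs_nbhs.
  - exact: (cvgrPdist_le _ _).1.
  - exact: (cvgrPdist_le _ _).1.
case/nbhs_ballP => r /= r0 Hr.
(* The side [h] is such that the parallelogram stays in the ball of radius [r];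
   the summand 1 avoids a division by zero. *)
pose h := r / (2 * (`|u| + `|v| + 1)).
have uv0 : 0 < `|u| + `|v| + 1 by rewrite ltr_wpDl // addr_ge0.
have h0 : 0 < h by rewrite divr_gt0 // mulr_gt0.
have Hst s t : 0 <= s <= h -> 0 <= t <= h -> ball x r (x + s *: u + t *: v).
  move=> /andP[s0 sh] /andP[t0 th].
  rewrite -ball_normE /= -addrA opprD addNKr normrN.
  apply: (le_lt_trans (ler_normD _ _)); rewrite !normrZ !ger0_norm //.
  apply: (@le_lt_trans _ _ (h * `|u| + h * `|v|)).
    by apply: lerD; apply: ler_wpM2r.
  rewrite -mulrDr /h mulrAC ltr_pdivrMr ?mulr_gt0 // ltr_pM2l //.
  by rewrite mulr_natl mulr2n; lra.
have [|s [t [sh th Est]]] := @second_difference V f O x u v h h0 _ Cf.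
  by move=> s t sh th; case: (Hr _ (Hst s t sh th)).
have [|s' [t' [sh' th' Est']]] := @second_difference V f O x v u h h0 _ Cf.
  by move=> s' t' sh' th'; rewrite addrAC; case: (Hr _ (Hst t' s' th' sh')).
have E : a (x + s *: u + t *: v) = b (x + t' *: u + s' *: v).
  apply: (@mulfI _ (h ^+ 2)); first by rewrite expf_neq0 // gt_eqF.
  rewrite /a /b -Est [x + t' *: u + _]addrAC -Est'.
  by rewrite [x + h *: v + _]addrAC; ring.
have [_ Ha _] := Hr _ (Hst s t sh th).
have [_ _ Hb] := Hr _ (Hst t' s' th' sh').
rewrite [e]splitr.
have -> : a x - b x = (a x - a (x + s *: u + t *: v)) - (b x - b (x + t' *: u + s' *: v)).
  by rewrite E; ring.
by apply: (le_trans (ler_normB _ _)); apply: lerD.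
Unshelve. all: by end_near. Qed.

Lemma schwarz V W (f : V -> W) (O : set V) (x u v : V) : framed W ->
  open O -> O x -> Ck 2 O f ->
  'd (fun z => 'd f z u) x v = 'd (fun z => 'd f z v) x u.
Proof.
move=> [I [e [c [cc ce]]]] oO Ox Cf; have [df Cf'] := Cf.
rewrite [LHS]ce [RHS]ce; apply: eq_bigr => i _; congr (_ *: _).
have H w w' : c i ('d (fun z => 'd f z w) x w') =
    'd (fun z => 'd (c i \o f) z w) x w'.
  have [dfw _] := Cf' w.
  have D := is_diff_lin (cc i) (differentiableP (dfw x Ox)).
  have E : {near x, c i \o (fun z => 'd f z w) =1 (fun z => 'd (c i \o f) z w)}.
    near=> z.
    have Oz : O z by near: z; exact: open_nbhs_nbhs.
    by rewrite (diff_valE w (is_diff_lin (cc i) (differentiableP (df z Oz)))).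
  by rewrite (diff_valE w' (near_eq_is_diff E D)).
rewrite !H; apply: (schwarz_real _ _ oO Ox).
exact: (Ck_lin oO (cc i) Cf).
Unshelve. all: by end_near. Qed.

(** The product rule for the pairing of ['d f] with a vector field. *)
Lemma is_diff_apply V W (f : V -> W) (O : set V) (X : V -> V) (y : V) :
  framed V -> open O -> O y -> Ck 2 O f -> differentiable X y ->
  is_diff y (fun z => 'd f z (X z))
    (fun v => 'd (fun z => 'd f z (X y)) y v + 'd f y ('d X y v)).
Proof.
move=> [I [e [c [cc ce]]]] oO Oy Cf dX; have [df Cf'] := Cf.
have ddf i : differentiable (fun z => 'd f z (e i)) y by have [H _] := Cf' (e i); exact: H.
have H i := is_diff_scale (is_diff_lin (cc i) (differentiableP dX)) (differentiableP (ddf i)).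
have {}H := is_diff_sum (index_enum I) H.
have E (X' : V -> V) : (fun z => 'd f z (X' z)) = fun z => \sum_i c i (X' z) *: 'd f z (e i).
  apply/funext => z; rewrite [X' z in LHS]ce linear_sum.
  by apply: eq_bigr => i _; rewrite linearZ.
rewrite E; apply: (is_diff_eq H); apply/funext => v.
rewrite big_split /=; congr (_ + _).
  have H' i := is_diff_scale (is_diff_cst (c i (X y)) y) (differentiableP (ddf i)).
  have {}H' := is_diff_sum (index_enum I) H'.
  rewrite (E (fun=> X y)) (diff_valE v H') /=.
  by apply: eq_bigr => i _; rewrite scale0r addr0.
rewrite ['d X y v in RHS]ce linear_sum.
by apply: eq_bigr => i _; rewrite linearZ.
Qed.

(** By the product rule, each of the two terms on the left is a second derivative
    of [f] plus ['d f] of a derivative of a field; the second derivatives cancel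
    by symmetry. *)
Lemma diff_lie_bracket (m : nat) W (f : 'cV[R]_m -> W) (O : set 'cV[R]_m)
    (X Y : vfield R m) (y : 'cV[R]_m) :
  framed W -> open O -> O y -> Ck 2 O f ->
  differentiable X y -> differentiable Y y ->
  'd (fun z => 'd f z (Y z)) y (X y) - 'd (fun z => 'd f z (X z)) y (Y y) =
  'd f y (lie_bracket X Y y).
Proof.
move=> fW oO Oy Cf dX dY.
have EY := diff_valE (X y) (is_diff_apply (framed_cV R m) oO Oy Cf dY).
have EX := diff_valE (Y y) (is_diff_apply (framed_cV R m) oO Oy Cf dX).
have ES := schwarz (Y y) (X y) fW oO Oy Cf.
have H (a b c d : W) : a = c -> a + b - (c + d) = b - d.
  by move=> ->; rewrite [c + d]addrC opprD addrA addrAC [c + b]addrC addrK.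
apply: (etrans (f_equal2 (fun a b : W => a - b) EY EX)).
apply: (etrans (H _ _ _ _ ES)).
by rewrite -linearB.
Qed.

End Schwarz.

(** * The exponential of a matrix *)

Section MatrixExponential.
Context {R : realType}.

Lemma cvg_bigsum (I : Type) (s : seq I) (u : I -> nat -> R) (l : I -> R) :
  (forall i, u i n @[n --> \oo] --> l i) ->
  (\sum_(i <- s) u i n) @[n --> \oo] --> \sum_(i <- s) l i.
Proof.
move=> ul; elim: s => [|i s IHs].
  by rewrite big_nil; under eq_fun do rewrite big_nil; exact: cvg_cst.
by rewrite big_cons; under eq_fun do rewrite big_cons; exact: cvgD.
Qed.

Lemma cvg_mx (p q : nat) (u : nat -> 'M[R]_(p, q)) (l : 'M[R]_(p, q)) :
  (forall i j, u n i j @[n --> \oo] --> l i j) -> u n @[n --> \oo] --> l.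
Proof.
move=> ul; apply/cvgrPdist_le => /= e e0; near=> n.
rewrite /Num.Def.normr/= mx_normrE (bigmax_le _ (ltW e0))//= => i _.
rewrite !mxE/=; move: i; near: n; apply: filter_forall => /= i.
exact: ((cvgrPdist_le _ _).1 (ul i.1 i.2)).
Unshelve. all: by end_near. Qed.

Section Fixed.
Context {m : nat} (A : 'M[R]_m).

(** The entries of [mexp (t *: A)] are power series in [t] with these
    coefficients, whose formal derivatives have the same shape. *)
Definition mexp_coef (i j : 'I_m) (k : nat) : R := (k`!%:R)^-1 * (A ^+ k) i j.

Definition mx_sumnorm : R := \sum_i \sum_j `|A i j|.

Lemma mx_sumnorm_ge0 : 0 <= mx_sumnorm.
Proof. by apply: sumr_ge0 => i _; apply: sumr_ge0. Qed.

(** Each column sum of absolute values of [A] is at most [mx_sumnorm]; this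
    geometric bound gives convergence by comparison with the exponential
    series. *)
Lemma expmx_bound k i j : `|(A ^+ k) i j| <= mx_sumnorm ^+ k.
Proof.
elim: k i j => [|k IHk] i j.
  by rewrite expr0 mxE expr0; case: (i == j); rewrite ?normr1 ?normr0.
rewrite exprSr mxE; apply: (le_trans (ler_norm_sum _ _ _)).
rewrite exprSr mulr_sumr; apply: ler_sum => l _; rewrite normrM.
apply: ler_pM => //; rewrite (bigD1 j) //= lerDl.
exact: sumr_ge0.
Qed.

Lemma cvg_pseries_mexp_coef i j x : cvgn (pseries (mexp_coef i j) x).
Proof.
apply: normed_cvg.
apply: series_le_cvg (is_cvg_series_exp_coeff (mx_sumnorm * `|x|)) => k //=.
  by rewrite /exp_coeff /= divr_ge0 // exprn_ge0 // mulr_ge0 // mx_sumnorm_ge0.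
rewrite /exp_coeff /mexp_coef /= !normrM normfV normr_nat normrX exprMn.
rewrite -mulrA mulrC; apply: ler_wpM2r; first by rewrite invr_ge0.
by apply: ler_wpM2r; [exact: exprn_ge0|exact: expmx_bound].
Qed.

Lemma scale_expmx (t : R) k : (t *: A) ^+ k = t ^+ k *: A ^+ k.
Proof.
elim: k => [|k IHk]; first by rewrite !expr0 scale1r.
by rewrite !exprSr IHk -!mulmxE -scalemxAl -scalemxAr scalerA mulrC.
Qed.

Lemma mexpE (t : R) i j : mexp (t *: A) i j = limn (pseries (mexp_coef i j) t).
Proof.
rewrite /mexp; set S := series _.
have -> : limn S = \matrix_(i, j) limn (pseries (mexp_coef i j) t).
  apply/cvg_lim => //; apply: cvg_mx => k l; rewrite mxE.
  rewrite (_ : (fun n => S n k l) = pseries (mexp_coef k l) t).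
    exact: cvg_pseries_mexp_coef.
  apply/funext => n; rewrite /S /series /pseries /= summxE.
  apply: eq_bigr => p _; rewrite scale_expmx !mxE /mexp_coef.
  by rewrite mulrCA mulrC.
by rewrite mxE.
Qed.

Lemma mexp_coef_diffs i j :
  pseries_diffs (mexp_coef i j) = fun k => (k`!%:R)^-1 * (A ^+ k.+1) i j.
Proof.
apply/funext => k; rewrite /pseries_diffs /mexp_coef factS natrM invfM.
by rewrite !mulrA divff ?mul1r // pnatr_eq0.
Qed.

Lemma cvg_pseries_lincomb (c : 'I_m -> R) (i j : 'I_m -> 'I_m) x (d : nat -> R) :
  (forall k, d k = \sum_l c l * mexp_coef (i l) (j l) k) ->
  pseries d x n @[n --> \oo] --> \sum_l c l * limn (pseries (mexp_coef (i l) (j l)) x).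
Proof.
move=> dE.
rewrite (_ : (fun n => _) = fun n => \sum_l c l * pseries (mexp_coef (i l) (j l)) x n).
  apply: cvg_bigsum => l; apply: cvgM; first exact: cvg_cst.
  exact: cvg_pseries_mexp_coef.
apply/funext => n; rewrite /pseries /series /=.
under [RHS]eq_bigr do rewrite mulr_sumr.
rewrite exchange_big; apply: eq_bigr => k _ /=; rewrite dE mulr_suml.
by apply: eq_bigr => l _; rewrite mulrA.
Qed.

(** The differentiated series is identified twice, from [A ^+ k.+1 = A * A ^+ k]
    and from [A ^+ k.+1 = A ^+ k * A]; uniqueness of the limit then shows that [A]
    commutes with its exponentials. *)
Lemma cvg_mexp_diffs_left i j x :
  pseries (pseries_diffs (mexp_coef i j)) x n @[n --> \oo] --> (A *m mexp (x *: A)) i j.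
Proof.
rewrite mexp_coef_diffs mxE; under [X in _ --> X]eq_bigr do rewrite mexpE.
apply: (@cvg_pseries_lincomb (A i) id (fun=> j)) => k.
rewrite exprS mxE mulr_sumr; apply: eq_bigr => l _.
by rewrite /mexp_coef mulrCA.
Qed.

Lemma cvg_mexp_diffs_right i j x :
  pseries (pseries_diffs (mexp_coef i j)) x n @[n --> \oo] --> (mexp (x *: A) *m A) i j.
Proof.
rewrite mexp_coef_diffs mxE; under [X in _ --> X]eq_bigr do rewrite mexpE mulrC.
apply: (@cvg_pseries_lincomb (A^~ j) (fun=> i) id) => k.
rewrite exprSr mxE mulr_sumr; apply: eq_bigr => l _.
by rewrite /mexp_coef; ring.
Qed.

Lemma mexp_comm x : A *m mexp (x *: A) = mexp (x *: A) *m A.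
Proof.
apply/matrixP => i j.
rewrite -(cvg_lim (@Rhausdorff R) (@cvg_mexp_diffs_left i j x)).
exact: (cvg_lim (@Rhausdorff R) (@cvg_mexp_diffs_right i j x)).
Qed.

Lemma mexp0 : mexp (0 *: A) = 1%:M.
Proof.
apply/matrixP => i j; rewrite mexpE; apply/cvg_lim => //.
apply: (cvg_trans (G := (mexp_coef i j 0) @[n --> \oo])).
  apply: near_eq_cvg; near=> n.
  have n0 : (0 < n)%N by near: n; exact: nbhs_infty_gt.
  rewrite /pseries /series /= -(prednK n0) big_nat_recl //= expr0 mulr1.
  by rewrite big1 ?addr0 // => k _; rewrite exprS mul0r mulr0.
by rewrite /mexp_coef fact0 invr1 mul1r expr0; exact: cvg_cst.
Unshelve. all: by end_near. Qed.

Lemma is_derive_mexp i j x :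
  is_derive x (1 : R) (fun t => mexp (t *: A) i j) ((mexp (x *: A) *m A) i j).
Proof.
have -> : (fun t => mexp (t *: A) i j) = fun t => limn (pseries (mexp_coef i j) t).
  by apply/funext => t; rewrite mexpE.
rewrite -(cvg_lim (@Rhausdorff R) (@cvg_mexp_diffs_right i j x)).
apply: (@pseries_snd_diffs _ _ (`|x| + 1)).
- exact: cvg_pseries_mexp_coef.
- by apply/cvg_ex; eexists; exact: cvg_mexp_diffs_right.
- rewrite mexp_coef_diffs.
  have -> : pseries_diffs (fun k => (k`!%:R)^-1 * (A ^+ k.+1) i j) =
      fun k => (k`!%:R)^-1 * (A ^+ k.+2) i j.
    apply/funext => k; rewrite /pseries_diffs factS natrM invfM.
    by rewrite !mulrA divff ?mul1r // pnatr_eq0.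
  apply/cvg_ex; eexists; apply: (@cvg_pseries_lincomb ((A ^+ 2)^~ j) (fun=> i) id) => k.
  rewrite -addn2 exprD mxE mulr_sumr; apply: eq_bigr => l _.
  by rewrite /mexp_coef; ring.
- by rewrite [ltRHS]ger0_norm ?addr_ge0 // ltrDl.
Qed.

Lemma mexp_mulmx_sum (E : 'M[R]_m) (w : 'cV[R]_m) :
  E *m w = \sum_i \sum_k E i k *: (w k 0 *: delta_mx i 0).
Proof.
rewrite [LHS]matrix_sum_delta; apply: eq_bigr => i _.
rewrite big_ord1 mxE scaler_suml; apply: eq_bigr => k _.
by rewrite scalerA.
Qed.

Lemma is_diff_mexp (x : R) (w : 'cV[R]_m) :
  is_diff x (fun t => mexp (t *: A) *m w)
    (fun s => s *: (mexp (x *: A) *m (A *m w))).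
Proof.
have D i k : is_diff x (fun t => mexp (t *: A) i k)
    (fun s => s *: (mexp (x *: A) *m A) i k).
  have [H1 H2] := is_derive_mexp i k x.
  have H3 := (derivable1_diffP _ _).1 H1.
  by apply: DiffDef => //; rewrite diff1E // derive1E H2.
have D' i k := is_diff_scale (D i k) (is_diff_cst (w k 0 *: delta_mx i 0 : 'cV[R]_m) x).
have {}D' i := is_diff_sum (index_enum 'I_m) (D' i).
have {}D' := is_diff_sum (index_enum 'I_m) D'.
rewrite (_ : (fun t : R => mexp (t *: A) *m w) =
  fun t : R => \sum_i \sum_k mexp (t *: A) i k *: (w k 0 *: delta_mx i 0)); last first.
  by apply/funext => t; exact: mexp_mulmx_sum.
apply: (is_diff_eq D'); apply/funext => s.
rewrite mulmxA mexp_mulmx_sum scaler_sumr; apply: eq_bigr => i _.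
rewrite scaler_sumr; apply: eq_bigr => k _.
by rewrite scaler0 add0r !scalerA.
Qed.

(** The derivative is again of the form [mexp (t *: A) *m w'], with
    [w' = A *m w], and the induction goes through with [w] varying. *)
Lemma Ck_mexp k (O : set R) (w : 'cV[R]_m) : open O ->
  Ck k O (fun t => mexp (t *: A) *m w).
Proof.
move=> oO; elim: k w => [|k IHk] w.
  by move=> x _; apply/differentiable_continuous; have [] := is_diff_mexp x w.
split=> [x _|s]; first by have [] := is_diff_mexp x w.
rewrite (_ : (fun x => _) = fun x : R => s *: (mexp (x *: A) *m (A *m w))).
  by apply: CkZ => //; exact: Ck_cst.
by apply/funext => x; rewrite (diff_valE _ (is_diff_mexp x w)).
Qed.

Lemma mulmx_sum_delta (E : 'M[R]_m) (w : 'cV[R]_m) :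
  E *m w = \sum_i w i 0 *: (E *m delta_mx i 0).
Proof.
rewrite [w in LHS]matrix_sum_delta mulmx_sumr; apply: eq_bigr => i _.
by rewrite big_ord1 scalemxAr.
Qed.

Variables (V : normedModType R) (T : V -> R) (F : V -> 'cV[R]_m).

Lemma is_diff_mexp_mul (x : V) (dT : V -> R) (dF : V -> 'cV[R]_m) :
  is_diff x T dT -> is_diff x F dF ->
  is_diff x (fun z => mexp (T z *: A) *m F z)
    (fun v => mexp (T x *: A) *m (dF v + dT v *: (A *m F x))).
Proof.
move=> DT DF.
have D1 i : is_diff x (fun z => mexp (T z *: A) *m (delta_mx i 0 : 'cV[R]_m))
    (fun v => dT v *: (mexp (T x *: A) *m (A *m (delta_mx i 0 : 'cV[R]_m)))).
  exact: (is_diff_comp DT (is_diff_mexp (T x) (delta_mx i 0))).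
have D3 i := is_diff_scale (is_diff_coord i DF) (D1 i).
have {}D3 := is_diff_sum (index_enum 'I_m) D3.
rewrite (_ : (fun z => mexp (T z *: A) *m F z) =
  fun z => \sum_i F z i 0 *: (mexp (T z *: A) *m delta_mx i 0)); last first.
  by apply/funext => z; exact: mulmx_sum_delta.
apply: (is_diff_eq D3); apply/funext => v.
rewrite mulmxDr big_split addrC /= -mulmx_sum_delta; congr (_ + _).
rewrite -scalemxAr !mulmxA mulmx_sum_delta scaler_sumr; apply: eq_bigr => i _.
by rewrite !scalerA mulrC mulmxA.
Qed.

Lemma Ck_mexp_mul k (O : set V) : open O -> Ck k O T -> Ck k O F ->
  Ck k O (fun z => mexp (T z *: A) *m F z).
Proof.
move=> oO CT CF.
rewrite (_ : (fun z => mexp (T z *: A) *m F z) =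
  fun z => \sum_i F z i 0 *: (mexp (T z *: A) *m delta_mx i 0)); last first.
  by apply/funext => z; exact: mulmx_sum_delta.
apply: (Ck_sum _ oO) => i; apply: (CkZ oO).
  exact: Ck_coord.
exact: (Ck_comp (framed_scalar R) oO (fun _ _ => I) CT (Ck_mexp k (delta_mx i 0) openT)).
Qed.

End Fixed.
End MatrixExponential.

(** * The symplectic form *)

Section SymplecticForm.
Context {R : realType} {p : nat}.
Implicit Types x y : 'cV[R]_(p + p).

Lemma OmegaDl x x' y : Omega (x + x') y = Omega x y + Omega x' y.
Proof. by rewrite /Omega linearD /= !mulmxDl mxE. Qed.

Lemma OmegaDr x y y' : Omega x (y + y') = Omega x y + Omega x y'.
Proof. by rewrite /Omega mulmxDr mxE. Qed.

Lemma OmegaZl a x y : Omega (a *: x) y = a * Omega x y.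
Proof. by rewrite /Omega linearZ /= -!scalemxAl mxE. Qed.

Lemma OmegaZr a x y : Omega x (a *: y) = a * Omega x y.
Proof. by rewrite /Omega -scalemxAr mxE. Qed.

Lemma OmegaNl x y : Omega (- x) y = - Omega x y.
Proof. by rewrite -scaleN1r OmegaZl mulN1r. Qed.

Lemma OmegaNr x y : Omega x (- y) = - Omega x y.
Proof. by rewrite -scaleN1r OmegaZr mulN1r. Qed.

Definition OmegaE := (OmegaDl, OmegaDr, OmegaNl, OmegaNr, OmegaZl, OmegaZr).

Lemma OmegaC x y : Omega x y = - Omega y x.
Proof.
rewrite /Omega; set J := block_mx _ _ _ _.
have JT : J^T = - J.
  by rewrite tr_block_mx opp_block_mx !linear0 linearN /= trmx1 ?oppr0 opprK.
have -> : (x^T *m J *m y) 0 0 = ((x^T *m J *m y)^T) 0 0 by rewrite [RHS]mxE.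
by rewrite !trmx_mul trmxK JT mulmxA mulmxN mulNmx mxE.
Qed.

Lemma Omega_self x : Omega x x = 0.
Proof. by have := OmegaC x x; lra. Qed.

(** The matrix of [Omega] squares to [-1]. *)
Lemma Omega_nondegenerate x : (forall y, Omega x y = 0) -> x = 0.
Proof.
rewrite /Omega; set J := block_mx _ _ _ _ => H.
have JJ : J *m J = - 1%:M.
  rewrite mulmx_block !mul0mx !mulmx0 !mulmxN !mulNmx !mulmx1 !add0r !addr0.
  by rewrite [in RHS]scalar_mx_block opp_block_mx !oppr0.
have xJ : x^T *m J = 0.
  apply/rowP => j; have := H (delta_mx j 0).
  by rewrite -colE mxE => ->; rewrite mxE.
apply: trmx_inj; rewrite linear0 -[x^T]mulmx1 -[1%:M]opprK -JJ.
by rewrite mulmxN mulmxA xJ mul0mx oppr0.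
Qed.

Lemma in_spE (A : 'M[R]_(p + p)) x y : in_sp A ->
  Omega x (A *m y) = - Omega (A *m x) y.
Proof. by move=> /(_ x y) H; lra. Qed.

Lemma Omega_sum_delta x y : Omega x y = \sum_i y i 0 * Omega x (delta_mx i 0).
Proof.
rewrite [y in LHS]matrix_sum_delta /Omega mulmx_sumr summxE.
apply: eq_bigr => i _; rewrite big_ord1 -scalemxAr mxE.
by [].
Qed.

End SymplecticForm.

Section OmegaCalculus.
Context {R : realType} (V : normedModType R) {p : nat}.
Implicit Types f g : V -> 'cV[R]_(p + p).

Lemma is_diff_Omega_l (w : 'cV[R]_(p + p)) (x : V) f (df : V -> 'cV[R]_(p + p)) :
  is_diff x f df -> is_diff x (fun z => Omega (f z) w) (fun v => Omega (df v) w).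
Proof.
pose c : 'cV[R]_(p + p) -> R := fun v => Omega v w.
have lc : linear c by move=> a u v; rewrite /c OmegaDl OmegaZl.
pose cM := GRing.isLinear.Build _ _ _ _ _ lc.
pose cL : {linear 'cV[R]_(p + p) -> R} := HB.pack c cM.
exact: (is_diff_lin (L := cL) (framed_continuous (framed_cV R _))).
Qed.

Lemma Ck_Omega_l (w : 'cV[R]_(p + p)) k (O : set V) f :
  open O -> Ck k O f -> Ck k O (fun z => Omega (f z) w).
Proof.
pose c : 'cV[R]_(p + p) -> R := fun v => Omega v w.
have lc : linear c by move=> a u v; rewrite /c OmegaDl OmegaZl.
pose cM := GRing.isLinear.Build _ _ _ _ _ lc.
pose cL : {linear 'cV[R]_(p + p) -> R} := HB.pack c cM.
move=> oO; exact: (Ck_lin (L := cL) oO (framed_continuous (framed_cV R _))).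
Qed.

Lemma is_diff_Omega (x : V) f g (df dg : V -> 'cV[R]_(p + p)) :
  is_diff x f df -> is_diff x g dg ->
  is_diff x (fun z => Omega (f z) (g z))
    (fun v => Omega (df v) (g x) + Omega (f x) (dg v)).
Proof.
move=> Df Dg.
have D i := is_diff_scale (is_diff_coord i Dg) (is_diff_Omega_l (delta_mx i 0) Df).
have {}D := is_diff_sum (index_enum 'I_(p + p)) D.
rewrite (_ : (fun z => Omega (f z) (g z)) =
  fun z => \sum_i g z i 0 *: Omega (f z) (delta_mx i 0)); last first.
  by apply/funext => z; exact: Omega_sum_delta.
apply: (is_diff_eq D); apply/funext => v.
by rewrite big_split /= -!Omega_sum_delta.
Qed.

Lemma Ck_Omega k (O : set V) f g : open O ->
  Ck k O f -> Ck k O g -> Ck k O (fun z => Omega (f z) (g z)).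
Proof.
move=> oO Cf Cg.
rewrite (_ : (fun z => Omega (f z) (g z)) =
  fun z => \sum_i g z i 0 *: Omega (f z) (delta_mx i 0)); last first.
  by apply/funext => z; exact: Omega_sum_delta.
apply: (Ck_sum _ oO) => i; apply: (CkZ oO); first exact: Ck_coord.
exact: Ck_Omega_l.
Qed.

End OmegaCalculus.

(** * The reduced connection and its curvature, seen on a slice *)

(** Linear identities between column vectors, checked on entries; products by a
    matrix and values of [Omega] count as unknowns. *)
Ltac vector_ring :=
  repeat (match goal with |- context [@mulmx ?T ?a ?b ?c ?B ?v] =>
    generalize (@mulmx T a b c B v); intro end);
  apply/matrixP => ? ?; rewrite !mxE;
  repeat (match goal with |- context [@fun_of_matrix _ _ _ ?B _ _] =>
    tryif is_var B then fail else generalize B; intro end);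
  repeat (match goal with |- context [@Omega ?T ?n ?x ?y] =>
    generalize (@Omega T n x y); intro end);
  ring.

Section Reduction.
Context {R : realType} {m p : nat}.
Variables (D : set 'cV[R]_m) (A : 'M[R]_(p + p)) (s : 'cV[R]_m -> 'cV[R]_(p + p)).
Local Notation smooth F := (forall k, Ck k D F).
Hypotheses (oD : open D) (Asp : in_sp A) (Cs : smooth s).
Hypothesis sS : forall y, D y -> Omega (s y) (A *m s y) = 1.
Implicit Types (W X Y Z : vfield R m) (F G : 'cV[R]_m -> 'cV[R]_(p + p)).
Implicit Types (f g : 'cV[R]_m -> R) (y w : 'cV[R]_m) (v : 'cV[R]_(p + p)).

(** The connection form of the slice: a tangent vector [w] lifts to
    ['d s y w + theta y w *: A s], the coefficient of [A s] being the one that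
    makes the lift orthogonal to [s] for [Omega]. *)
Definition theta y w : R := Omega ('d s y w) (s y).

Definition lift_at y w : 'cV[R]_(p + p) := 'd s y w + theta y w *: (A *m s y).

Definition lift X y : 'cV[R]_(p + p) := lift_at y (X y).

(** The derivative along the horizontal lift of [X] of the field
    [chi (y, t) |-> exp (t A) (F y)], read on the slice. *)
Definition cov X F y : 'cV[R]_(p + p) :=
  'd F y (X y) + theta y (X y) *: (A *m F y).

(** The projection onto the horizontal space parallel to the plane spanned by
    [s] and [A s], on which [Omega] is nondegenerate. *)
Definition proj y v : 'cV[R]_(p + p) :=
  v - Omega v (A *m s y) *: s y + Omega v (s y) *: (A *m s y).

Lemma Ck_differentiable (W' : normedModType R) (F : 'cV[R]_m -> W') y :
  smooth F -> D y -> differentiable F y.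
Proof. by move=> /(_ 1%N) [dF _] /dF. Qed.

Lemma Ck_theta k X : smooth X -> Ck k D (fun y => theta y (X y)).
Proof.
move=> CX; apply: (Ck_Omega oD); last exact: Cs.
exact: (Ck_apply (framed_cV R m) oD (Cs k.+1) (CX k)).
Qed.

Lemma Ck_cov k X F : smooth X -> smooth F -> Ck k D (cov X F).
Proof.
move=> CX CF; apply: (CkD oD).
  exact: (Ck_apply (framed_cV R m) oD (CF k.+1) (CX k)).
by apply: (CkZ oD); [exact: Ck_theta|exact: (Ck_mulmx A oD (CF k))].
Qed.

Lemma Ck_lift k X : smooth X -> Ck k D (lift X).
Proof. by move=> CX; exact: (Ck_cov k CX Cs). Qed.

Lemma lift_atB y w w' : lift_at y (w - w') = lift_at y w - lift_at y w'.
Proof.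
rewrite /lift_at /theta linearB /= OmegaDl OmegaNl.
vector_ring.
Qed.

Lemma Omega_s_As y : D y -> Omega (A *m s y) (s y) = -1.
Proof. by move=> /sS; rewrite OmegaC => <-; rewrite opprK. Qed.

(** Differentiate [Omega s (A s) = 1], the two terms being equal because [A] is in
    the symplectic Lie algebra. *)
Lemma Omega_ds_As y w : D y -> Omega ('d s y w) (A *m s y) = 0.
Proof.
move=> Dy; have ds := differentiableP (Ck_differentiable Cs Dy).
have H := is_diff_Omega ds (is_diff_mulmx A ds).
have E : {near y, (fun z => Omega (s z) (A *m s z)) =1 (fun=> 1)}.
  by near=> z; apply: sS; near: z; exact: open_nbhs_nbhs.
have := diff_valE w (near_eq_is_diff E H).
have /= := diff_valE w (is_diff_cst (1 : R) y) => ->.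
rewrite (in_spE (s y) _ Asp) (OmegaC (A *m s y)) opprK.
by move=> H0; have {}H0 : 0 = Omega ('d s y w) (A *m s y) + Omega ('d s y w) (A *m s y) := H0; lra.
Unshelve. all: by end_near. Qed.

Lemma Omega_lift_at_s y w : D y -> Omega (lift_at y w) (s y) = 0.
Proof.
by move=> Dy; rewrite OmegaDl OmegaZl Omega_s_As // mulrN1 subrr.
Qed.

Lemma Omega_lift_at_As y w : D y -> Omega (lift_at y w) (A *m s y) = 0.
Proof.
by move=> Dy; rewrite OmegaDl OmegaZl Omega_self mulr0 addr0 Omega_ds_As.
Qed.

Lemma Omega_A_lift_at_s y w : D y -> Omega (A *m lift_at y w) (s y) = 0.
Proof.
move=> Dy; have := in_spE (lift_at y w) (s y) Asp.
by rewrite Omega_lift_at_As // => H; lra.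
Qed.

Lemma projD y v v' : proj y (v + v') = proj y v + proj y v'.
Proof. by rewrite /proj !OmegaE; vector_ring. Qed.

Lemma projZ y a v : proj y (a *: v) = a *: proj y v.
Proof. by rewrite /proj !OmegaE; vector_ring. Qed.

Lemma projN y v : proj y (- v) = - proj y v.
Proof. by rewrite -scaleN1r projZ scaleN1r. Qed.

Lemma projB y v v' : proj y (v - v') = proj y v - proj y v'.
Proof. by rewrite projD projN. Qed.

Lemma proj_s y : D y -> proj y (s y) = 0.
Proof.
by move=> Dy; rewrite /proj Omega_self sS // scale1r scale0r subrr addr0.
Qed.

Lemma proj_As y : D y -> proj y (A *m s y) = 0.
Proof.
move=> Dy; rewrite /proj Omega_self Omega_s_As // scale0r subr0 scaleN1r.
exact: subrr.
Qed.

Lemma proj_lift_at y w : D y -> proj y (lift_at y w) = lift_at y w.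
Proof.
move=> Dy; rewrite /proj Omega_lift_at_s // Omega_lift_at_As //.
by rewrite !scale0r subr0 addr0.
Qed.

Lemma proj_horizontal y v : D y -> horizontal A (s y) (proj y v).
Proof.
move=> Dy; split; rewrite /proj !OmegaE Omega_self.
  by rewrite Omega_s_As // mulr0 oppr0 addr0 mulrN1 subrr.
by rewrite sS // mulr1 mulr0 addr0 subrr.
Qed.

Lemma Omega_proj y v v' : Omega v (s y) = 0 -> Omega v (A *m s y) = 0 ->
  Omega v (proj y v') = Omega v v'.
Proof. by move=> vs vAs; rewrite /proj !OmegaE vs vAs; ring. Qed.

(** Differentiability is carried along with the value, so that the derivation
    rules below can be composed as proof terms. *)
Definition is_cov X F y c := differentiable F y /\ cov X F y = c.
Definition is_der X f y c := differentiable f y /\ 'd f y (X y) = c.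

Lemma covE X F (dF : 'cV[R]_m -> 'cV[R]_(p + p)) y : is_diff y F dF ->
  cov X F y = dF (X y) + theta y (X y) *: (A *m F y).
Proof. by move=> H; rewrite /cov (diff_valE _ H). Qed.

Lemma is_cov_near X F G y c :
  {near y, F =1 G} -> is_cov X F y c -> is_cov X G y c.
Proof.
move=> FG [dF <-]; have DG := near_eq_is_diff FG (differentiableP dF).
split; first by have [] := DG.
apply: (etrans (covE X DG)); have <- : F y = G y := nbhs_singleton FG.
by [].
Qed.

Lemma is_covD X F G y c d : is_cov X F y c -> is_cov X G y d ->
  is_cov X (fun z => F z + G z) y (c + d).
Proof.
move=> [dF <-] [dG <-].
have H := is_diff_add (differentiableP dF) (differentiableP dG).
split; first by have [] := H.
apply: (etrans (covE X H)); rewrite /cov mulmxDr scalerDr.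
exact: addrACA.
Qed.

Lemma is_cov_scale X f G y c d : is_der X f y c -> is_cov X G y d ->
  is_cov X (fun z => f z *: G z) y (c *: G y + f y *: d).
Proof.
move=> [df <-] [dG <-].
have H := is_diff_scale (differentiableP df) (differentiableP dG).
split; first by have [] := H.
apply: (etrans (covE X H)); rewrite /cov -scalemxAr.
have alg (a b t : R) (u v w : 'cV[R]_(p + p)) :
  a *: u + b *: v + t *: (a *: w) = b *: v + a *: (u + t *: w) by vector_ring.
exact: alg.
Qed.

Lemma is_covN X G y d : is_cov X G y d -> is_cov X (fun z => - G z) y (- d).
Proof.
move=> [dG <-]; have H := is_diffN (differentiableP dG).
split; first by have [] := H.
apply: (etrans (covE X H)); rewrite /cov mulmxN scalerN.
exact: esym (opprD _ _).
Qed.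

Lemma is_cov_mulmx X G y d : is_cov X G y d ->
  is_cov X (fun z => A *m G z) y (A *m d).
Proof.
move=> [dG <-]; have H := is_diff_mulmx A (differentiableP dG).
split; first by have [] := H.
by apply: (etrans (covE X H)); rewrite /cov mulmxDr scalemxAr.
Qed.

Lemma is_cov_Ck X F y : smooth F -> D y -> is_cov X F y (cov X F y).
Proof. by move=> CF Dy; split=> //; exact: Ck_differentiable. Qed.

Lemma is_cov_s X y : D y -> is_cov X s y (lift X y).
Proof. by move=> Dy; split=> //; exact: Ck_differentiable. Qed.

(** The contributions of [theta] cancel since [A] is skew for [Omega]. *)
Lemma is_der_Omega X F G y c d : is_cov X F y c -> is_cov X G y d ->
  is_der X (fun z => Omega (F z) (G z)) y (Omega c (G y) + Omega (F y) d).
Proof.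
move=> [dF <-] [dG <-].
have H := is_diff_Omega (differentiableP dF) (differentiableP dG).
split; first by have [] := H.
apply: (etrans (diff_valE _ H)); rewrite /cov !OmegaE (in_spE (F y)) //.
by ring.
Qed.

Lemma is_diff_cov Y F y : smooth Y -> smooth F -> D y ->
  is_diff y (cov Y F) (fun w => 'd (fun z => 'd F z (Y z)) y w +
    (theta y (Y y) *: (A *m 'd F y w) +
     (Omega ('d (fun z => 'd s z (Y z)) y w) (s y) +
      Omega ('d s y (Y y)) ('d s y w)) *: (A *m F y))).
Proof.
move=> CY CF Dy.
have C1 k : Ck k D (fun z => 'd F z (Y z)).
  exact: (Ck_apply (framed_cV R m) oD (CF k.+1) (CY k)).
have C2 k : Ck k D (fun z => 'd s z (Y z)).
  exact: (Ck_apply (framed_cV R m) oD (Cs k.+1) (CY k)).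
have D1 := differentiableP (Ck_differentiable C1 Dy).
have D2 := differentiableP (Ck_differentiable C2 Dy).
have Ds := differentiableP (Ck_differentiable Cs Dy).
have DF := differentiableP (Ck_differentiable CF Dy).
exact: (is_diff_add D1 (is_diff_scale (is_diff_Omega D2 Ds) (is_diff_mulmx A DF))).
Qed.

Lemma Omega_lift_at_lift_at y w w' : D y ->
  Omega (lift_at y w) (lift_at y w') = Omega ('d s y w) ('d s y w').
Proof.
move=> Dy; have H1 := Omega_lift_at_As w Dy; have H2 := Omega_ds_As w' Dy.
move: H1 H2; rewrite /lift_at.
generalize ('d s y w) ('d s y w') => a b.
by rewrite (OmegaC b) !OmegaE Omega_self => H1 H2; nra.
Qed.

(** The curvature of the covariant derivative is the exterior derivative of
    [theta], acting through [A].  The second derivatives of [F] and of [s] combine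
    into derivatives along the bracket, and what remains of the derivative of
    [theta] is [Omega (ds Y) (ds X) - Omega (ds X) (ds Y)]. *)
Lemma cov_commutator X Y F y :
  smooth X -> smooth Y -> smooth F -> D y ->
  cov X (cov Y F) y - cov Y (cov X F) y - cov (lie_bracket X Y) F y =
  - (2 * Omega (lift X y) (lift Y y)) *: (A *m F y).
Proof.
move=> CX CY CF Dy; rewrite Omega_lift_at_lift_at //.
have dX := Ck_differentiable CX Dy; have dY := Ck_differentiable CY Dy.
have BF := diff_lie_bracket (framed_cV R _) oD Dy (CF 2%N) dX dY.
have Bs := diff_lie_bracket (framed_cV R _) oD Dy (Cs 2%N) dX dY.
have E1 : cov X (cov Y F) y = _ := f_equal2 +%R (diff_valE (X y) (is_diff_cov CY CF Dy)) erefl.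
have E2 : cov Y (cov X F) y = _ := f_equal2 +%R (diff_valE (Y y) (is_diff_cov CX CF Dy)) erefl.
apply: (etrans (f_equal2 (fun a b => a - b - _) E1 E2)) => {E1 E2}.
rewrite /cov /theta.
(* Once the derivatives are replaced by unknown vectors, an identity in which the
   symmetry of second derivatives enters through its two hypotheses. *)
have alg (FB sB FXY FYX sXY sYX FX FY sX sY s0 F0 : 'cV[R]_(p + p)) :
  FXY - FYX = FB -> sXY - sYX = sB ->
  FXY + (Omega sY s0 *: (A *m FX) + (Omega sXY s0 + Omega sY sX) *: (A *m F0))
    + Omega sX s0 *: (A *m (FY + Omega sY s0 *: (A *m F0)))
  - (FYX + (Omega sX s0 *: (A *m FY) + (Omega sYX s0 + Omega sX sY) *: (A *m F0))
    + Omega sY s0 *: (A *m (FX + Omega sX s0 *: (A *m F0))))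
  - (FB + Omega sB s0 *: (A *m F0)) = - (2 * Omega sX sY) *: (A *m F0).
  move=> <- <-; rewrite !mulmxDr -!scalemxAr (OmegaC sY sX) !OmegaE.
  vector_ring.
exact: (alg _ _ _ _ _ _ _ _ _ _ _ _ BF Bs).
Qed.

Variable nabla : connection R m.
Hypothesis Cnabla : forall X Y, smooth X -> smooth Y ->
  smooth (nabla X Y).
Hypothesis lift_nabla : forall X Y, smooth X -> smooth Y ->
  forall y, D y -> lift (nabla X Y) y = cov X (lift Y) y
    - Omega (A *m lift X y) (lift Y y) *: s y
    + Omega (lift X y) (lift Y y) *: (A *m s y).

(** The lift of [A] to an endomorphism of the tangent spaces of the reduced space,
    applied to [X]: the horizontal part of [A *m lift X]. *)
Definition rho X y := A *m lift X y - Omega (A *m lift X y) (A *m s y) *: s y.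

Lemma proj_A_lift X y : D y -> proj y (A *m lift X y) = rho X y.
Proof.
by move=> Dy; rewrite /proj /rho /lift Omega_A_lift_at_s // scale0r addr0.
Qed.

(** The two correction terms of the connection are multiples of [s] and [A s]. *)
Lemma proj_cov_lift X Y y : smooth X -> smooth Y -> D y ->
  proj y (cov X (lift Y) y) = lift (nabla X Y) y.
Proof.
move=> CX CY Dy; rewrite -[RHS]proj_lift_at // -/(lift (nabla X Y) y).
rewrite lift_nabla // !projD projN !projZ proj_s // proj_As //.
by rewrite !scaler0 oppr0 !addr0.
Qed.

(** Differentiating the correction terms of [nabla Y Z], only the derivatives of
    [s] and [A s] survive the projection. *)
Lemma lift_nabla2 X Y Z y :
  smooth X -> smooth Y -> smooth Z -> D y ->
  lift (nabla X (nabla Y Z)) y = proj y (cov X (cov Y (lift Z)) y)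
    - Omega (A *m lift Y y) (lift Z y) *: lift X y
    + Omega (lift Y y) (lift Z y) *: rho X y.
Proof.
move=> CX CY CZ Dy.
rewrite -(proj_cov_lift CX (Cnabla CY CZ) Dy).
have LY := is_cov_Ck X (fun k => Ck_lift k CY) Dy.
have LZ := is_cov_Ck X (fun k => Ck_lift k CZ) Dy.
have Ss := is_cov_s X Dy.
have H := is_cov_Ck X (fun k => Ck_cov k CY (fun k => Ck_lift k CZ)) Dy.
have H1 := is_cov_scale (is_der_Omega (is_cov_mulmx LY) LZ) Ss.
have H2 := is_cov_scale (is_der_Omega LY LZ) (is_cov_mulmx Ss).
have {H H1 H2 LY LZ Ss} H := is_covD (is_covD H (is_covN H1)) H2.
have E : {near y, (fun z => cov Y (lift Z) z
    - Omega (A *m lift Y z) (lift Z z) *: s z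
    + Omega (lift Y z) (lift Z z) *: (A *m s z)) =1 lift (nabla Y Z)}.
  near=> z; rewrite -lift_nabla //.
  by near: z; exact: open_nbhs_nbhs.
have [_ ->] := is_cov_near E H.
rewrite !projD projN !projD !projZ proj_s // proj_As //.
by rewrite !scaler0 !add0r /lift proj_lift_at // -/(lift X y) proj_A_lift.
Unshelve. all: by end_near. Qed.

Definition lifted_curvature X Y Z y :=
  Omega (A *m lift X y) (lift Z y) *: lift Y y
  - Omega (A *m lift Y y) (lift Z y) *: lift X y
  + Omega (lift Y y) (lift Z y) *: rho X y
  - Omega (lift X y) (lift Z y) *: rho Y y
  - (2 * Omega (lift X y) (lift Y y)) *: rho Z y.

Lemma Ck_lie_bracket X Y : smooth X -> smooth Y ->
  smooth (lie_bracket X Y).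
Proof.
move=> CX CY k; rewrite /lie_bracket.
rewrite (_ : (fun y => _) = fun y => 'd Y y (X y) + (-1) *: 'd X y (Y y)); last first.
  by apply/funext => y; rewrite scaleN1r.
apply: (CkD oD); first exact: (Ck_apply (framed_cV R m) oD (CY k.+1) (CX k)).
apply: (CkZ oD); first exact: Ck_cst.
exact: (Ck_apply (framed_cV R m) oD (CX k.+1) (CY k)).
Qed.

Lemma Ck_curvature X Y Z :
  smooth X -> smooth Y -> smooth Z ->
  smooth (curvature nabla X Y Z).
Proof.
move=> CX CY CZ k; apply: (CkB oD); [apply: (CkB oD)|].
- exact: (Cnabla CX (Cnabla CY CZ)).
- exact: (Cnabla CY (Cnabla CX CZ)).
- exact: (Cnabla (Ck_lie_bracket CX CY) CZ).
Qed.

Lemma lift_curvature X Y Z y :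
  smooth X -> smooth Y -> smooth Z -> D y ->
  lift (curvature nabla X Y Z) y = lifted_curvature X Y Z y.
Proof.
move=> CX CY CZ Dy; rewrite /lift /curvature !lift_atB -!/(lift _ y).
rewrite !lift_nabla2 // -(proj_cov_lift (Ck_lie_bracket CX CY) CZ Dy).
have E := cov_commutator CX CY (fun k => Ck_lift k CZ) Dy.
have {}E : (2 * Omega (lift X y) (lift Y y)) *: rho Z y =
   - (proj y (cov X (cov Y (lift Z)) y) - proj y (cov Y (cov X (lift Z)) y)
   - proj y (cov (lie_bracket X Y) (lift Z) y)).
  rewrite -proj_A_lift // -projZ -[_ *: (A *m _)]opprK -scaleNr -E projN.
  by rewrite (projB y (_ - _)) (projB y (cov X _ y)).
rewrite /lifted_curvature E.
have alg (a b c d : R) (P Q S X' Y' rX rY : 'cV[R]_(p + p)) :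
  P - a *: X' + b *: rX - (Q - c *: Y' + d *: rY) - S =
  c *: Y' - a *: X' + b *: rX - d *: rY - - (P - Q - S) by vector_ring.
exact: alg.
Qed.

Lemma proj_id y v : Omega v (s y) = 0 -> Omega v (A *m s y) = 0 -> proj y v = v.
Proof. by move=> vs vAs; rewrite /proj vs vAs !scale0r subr0 addr0. Qed.

Lemma proj_lift X y : D y -> proj y (lift X y) = lift X y.
Proof. exact: proj_lift_at. Qed.

Lemma proj_rho X y : D y -> proj y (rho X y) = rho X y.
Proof.
move=> Dy; rewrite -proj_A_lift //.
by have [] := proj_horizontal (A *m lift X y) Dy; exact: proj_id.
Qed.

(** The horizontal part of a covariant derivative.  On lifts it is the reduced
    connection, and it still obeys the product rule on horizontal functions. *)
Definition is_pcov X F y c := differentiable F y /\ proj y (cov X F y) = c.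

Lemma is_der_eq X f y c d : is_der X f y c -> c = d -> is_der X f y d.
Proof. by move=> H <-. Qed.

Lemma is_pcov_eq X F y c d : is_pcov X F y c -> c = d -> is_pcov X F y d.
Proof. by move=> H <-. Qed.

Lemma is_cov_pcov X F y c : is_cov X F y c -> is_pcov X F y (proj y c).
Proof. by move=> [dF <-]. Qed.

Lemma is_pcovE X F y c : is_pcov X F y c -> is_cov X F y (cov X F y) /\ proj y (cov X F y) = c.
Proof. by move=> [dF <-]. Qed.

Lemma is_pcovD X F G y c d : is_pcov X F y c -> is_pcov X G y d ->
  is_pcov X (fun z => F z + G z) y (c + d).
Proof.
move=> /is_pcovE[HF <-] /is_pcovE[HG <-].
by rewrite -projD; exact: is_cov_pcov (is_covD HF HG).
Qed.

Lemma is_pcovN X G y d : is_pcov X G y d -> is_pcov X (fun z => - G z) y (- d).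
Proof.
by move=> /is_pcovE[HG <-]; rewrite -projN; exact: is_cov_pcov (is_covN HG).
Qed.

Lemma is_pcov_scale X f G y c d : proj y (G y) = G y ->
  is_der X f y c -> is_pcov X G y d ->
  is_pcov X (fun z => f z *: G z) y (c *: G y + f y *: d).
Proof.
move=> GG Hf /is_pcovE[HG <-].
by rewrite -[in c *: _]GG -!projZ -projD; exact: is_cov_pcov (is_cov_scale Hf HG).
Qed.

Lemma is_der_scale X (a : R) f y c :
  is_der X f y c -> is_der X (fun z => a * f z) y (a * c).
Proof.
move=> [df <-]; have H := is_diff_scale (is_diff_cst a y) (differentiableP df).
split; first by have [] := H.
by apply: (etrans (diff_valE _ H)); rewrite scale0r addr0.
Qed.

(** The horizontal part of the acceleration [A^2 x] of the flow lines. *)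
Definition accel y := proj y (A *m (A *m s y)).

(** The pairing of [accel] with the lift of [X], see accel_formE. *)
Definition accel_form X y := Omega (A *m lift X y) (A *m s y).

(** The opposite of the derivative along [W] of the endomorphism [rho],
    applied to [X]. *)
Definition accel_term W X y :=
  Omega (lift W y) (lift X y) *: accel y + accel_form X y *: lift W y.

Section CovariantDerivative.
Variables (W : vfield R m) (CW : smooth W).

Lemma cov_lift X y : smooth X -> D y ->
  cov W (lift X) y = lift (nabla W X) y
    + Omega (A *m lift W y) (lift X y) *: s y
    - Omega (lift W y) (lift X y) *: (A *m s y).
Proof.
move=> CX Dy; rewrite (lift_nabla CW CX Dy).
have alg (u v w : 'cV[R]_(p + p)) : u = u - v + w + v - w by vector_ring.
exact: alg.
Qed.

Lemma is_cov_lift X y : smooth X -> D y ->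
  is_cov W (lift X) y (lift (nabla W X) y
    + Omega (A *m lift W y) (lift X y) *: s y
    - Omega (lift W y) (lift X y) *: (A *m s y)).
Proof.
move=> CX Dy; split; last exact: cov_lift.
by have [] := is_cov_Ck W (fun k => Ck_lift k CX) Dy.
Qed.

Lemma is_pcov_lift X y : smooth X -> D y ->
  is_pcov W (lift X) y (lift (nabla W X) y).
Proof.
move=> CX Dy; split; last exact: proj_cov_lift.
by have [] := is_cov_Ck W (fun k => Ck_lift k CX) Dy.
Qed.

(** This is the compatibility of the reduced connection with the reduced form:
    the corrections along [s] and [A s] are orthogonal to lifts. *)
Lemma is_der_Omega_lift X Y y :
  smooth X -> smooth Y -> D y ->
  is_der W (fun z => Omega (lift X z) (lift Y z)) y
    (Omega (lift (nabla W X) y) (lift Y y) + Omega (lift X y) (lift (nabla W Y) y)).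
Proof.
move=> CX CY Dy.
have H := is_der_Omega (is_cov_lift CX Dy) (is_cov_lift CY Dy).
apply: (is_der_eq H).
have h1 : Omega (lift X y) (s y) = 0 by exact: Omega_lift_at_s.
have h2 : Omega (lift X y) (A *m s y) = 0 by exact: Omega_lift_at_As.
have h3 : Omega (s y) (lift Y y) = 0 by rewrite OmegaC Omega_lift_at_s // oppr0.
have h4 : Omega (A *m s y) (lift Y y) = 0.
  by rewrite OmegaC Omega_lift_at_As // oppr0.
move: h1 h2 h3 h4.
generalize (lift (nabla W X) y) (lift (nabla W Y) y) (lift W y) (lift X y) (lift Y y).
by move=> a b w x z h1 h2 h3 h4; rewrite !OmegaE h1 h2 h3 h4; ring.
Qed.

(** Here the correction along [A s] does contribute, through [A^2 s]. *)
Lemma is_der_Omega_A_lift X Y y :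
  smooth X -> smooth Y -> D y ->
  is_der W (fun z => Omega (A *m lift X z) (lift Y z)) y
    (Omega (A *m lift (nabla W X) y) (lift Y y)
     + Omega (A *m lift X y) (lift (nabla W Y) y)
     - Omega (lift W y) (lift X y) * accel_form Y y
     - Omega (lift W y) (lift Y y) * accel_form X y).
Proof.
move=> CX CY Dy.
have H := is_der_Omega (is_cov_mulmx (is_cov_lift CX Dy)) (is_cov_lift CY Dy).
apply: (is_der_eq H).
have h1 : Omega (A *m s y) (lift Y y) = 0.
  by rewrite OmegaC Omega_lift_at_As // oppr0.
have h2 : Omega (A *m lift X y) (s y) = 0 by exact: Omega_A_lift_at_s.
have h3 : Omega (A *m (A *m s y)) (lift Y y) = accel_form Y y.
  have := in_spE (A *m s y) (lift Y y) Asp.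
  by rewrite /accel_form (OmegaC (A *m lift Y y)) => ->; rewrite opprK.
have h4 : Omega (A *m lift X y) (A *m s y) = accel_form X y by [].
move: h1 h2 h3 h4; generalize (accel_form X y) (accel_form Y y).
generalize (lift (nabla W X) y) (lift (nabla W Y) y) (lift W y) (lift X y) (lift Y y).
move=> a b w x z qx qy h1 h2 h3 h4.
by rewrite !mulmxDr mulmxN -!scalemxAr !OmegaE h1 h2 h3 h4; ring.
Qed.

(** Two terms break the parallelism of [rho]: the correction along [A s] in the
    derivative of the lift is sent by [A] to [A^2 s], and the multiple of [s]
    removed from [A *m lift X] has a horizontal derivative, a multiple of the
    lift of [W]. *)
Lemma is_pcov_rho X y : smooth X -> D y ->
  is_pcov W (rho X) y (rho (nabla W X) y - accel_term W X y).
Proof.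
move=> CX Dy.
have H1 := is_cov_mulmx (is_cov_lift CX Dy).
have H2 := is_cov_scale (is_der_Omega H1 (is_cov_mulmx (is_cov_s W Dy))) (is_cov_s W Dy).
have H := is_cov_pcov (is_covD H1 (is_covN H2)).
apply: (is_pcov_eq H).
rewrite projB projD !projZ proj_s // proj_lift // scaler0 add0r.
rewrite mulmxDr mulmxN mulmxDr -!scalemxAr projB projD !projZ proj_As //.
rewrite proj_A_lift // scaler0 addr0 /accel_term opprD addrA.
by [].
Qed.

(** What the product rule applied to [lifted_curvature] leaves beside the
    derivatives of [X], [Y] and [Z]: the value of the derivative of the curvature
    tensor. *)
Definition curvature_defect X Y Z y :=
  - (Omega (lift W y) (lift X y) * accel_form Z y
     + Omega (lift W y) (lift Z y) * accel_form X y) *: lift Y y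
  + (Omega (lift W y) (lift Y y) * accel_form Z y
     + Omega (lift W y) (lift Z y) * accel_form Y y) *: lift X y
  - Omega (lift Y y) (lift Z y) *: accel_term W X y
  + Omega (lift X y) (lift Z y) *: accel_term W Y y
  + (2 * Omega (lift X y) (lift Y y)) *: accel_term W Z y.

Lemma is_pcov_lifted_curvature X Y Z y :
  smooth X -> smooth Y -> smooth Z -> D y ->
  is_pcov W (lifted_curvature X Y Z) y (lifted_curvature (nabla W X) Y Z y + lifted_curvature X (nabla W Y) Z y
    + lifted_curvature X Y (nabla W Z) y + curvature_defect X Y Z y).
Proof.
move=> CX CY CZ Dy.
have H1 := is_pcov_scale (proj_lift Y Dy) (is_der_Omega_A_lift CX CZ Dy) (is_pcov_lift CY Dy).
have H2 := is_pcov_scale (proj_lift X Dy) (is_der_Omega_A_lift CY CZ Dy) (is_pcov_lift CX Dy).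
have H3 := is_pcov_scale (proj_rho X Dy) (is_der_Omega_lift CY CZ Dy) (is_pcov_rho CX Dy).
have H4 := is_pcov_scale (proj_rho Y Dy) (is_der_Omega_lift CX CZ Dy) (is_pcov_rho CY Dy).
have H5 := is_pcov_scale (proj_rho Z Dy) (is_der_scale 2 (is_der_Omega_lift CX CY Dy)) (is_pcov_rho CZ Dy).
have H := is_pcovD (is_pcovD (is_pcovD (is_pcovD H1 (is_pcovN H2)) H3) (is_pcovN H4)) (is_pcovN H5).
apply: (is_pcov_eq H).
rewrite /lifted_curvature /curvature_defect.
generalize (rho (nabla W X) y) (rho (nabla W Y) y) (rho (nabla W Z) y).
generalize (rho X y) (rho Y y) (rho Z y).
generalize (accel_term W X y) (accel_term W Y y) (accel_term W Z y).
generalize (accel_form X y) (accel_form Y y) (accel_form Z y).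
generalize (lift (nabla W X) y) (lift (nabla W Y) y) (lift (nabla W Z) y).
generalize (lift W y) (lift X y) (lift Y y) (lift Z y).
move=> *; vector_ring.
Qed.

Lemma lift_cov_curvature X Y Z y :
  smooth X -> smooth Y -> smooth Z -> D y ->
  lift (cov_curvature nabla W X Y Z) y = curvature_defect X Y Z y.
Proof.
move=> CX CY CZ Dy.
have L a b c d : lift_at y (a - b - c - d) =
  lift_at y a - lift_at y b - lift_at y c - lift_at y d by rewrite !lift_atB.
have E0 : lift (cov_curvature nabla W X Y Z) y =
    lift (nabla W (curvature nabla X Y Z)) y
    - lift (curvature nabla (nabla W X) Y Z) y
    - lift (curvature nabla X (nabla W Y) Z) y
    - lift (curvature nabla X Y (nabla W Z)) y by exact: L.
rewrite E0 (lift_curvature (Cnabla CW CX) CY CZ Dy).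
rewrite (lift_curvature CX (Cnabla CW CY) CZ Dy).
rewrite (lift_curvature CX CY (Cnabla CW CZ) Dy).
rewrite -(proj_cov_lift CW (Ck_curvature CX CY CZ) Dy).
have E : {near y, lifted_curvature X Y Z =1 lift (curvature nabla X Y Z)}.
  near=> z; rewrite lift_curvature //.
  by near: z; exact: open_nbhs_nbhs.
have [HE P] := is_pcovE (is_pcov_lifted_curvature CX CY CZ Dy).
have [_ ->] := is_cov_near E HE.
rewrite P.
have alg (a b c d : 'cV[R]_(p + p)) : a + b + c + d - a - b - c = d by vector_ring.
exact: alg.
Unshelve. all: by end_near. Qed.

End CovariantDerivative.

Lemma accel_formE X y : D y -> accel_form X y = Omega (accel y) (lift X y).
Proof.
move=> Dy; rewrite /accel OmegaC Omega_proj ?Omega_lift_at_s ?Omega_lift_at_As //.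
rewrite /accel_form -OmegaC.
have := in_spE (A *m s y) (lift X y) Asp.
by rewrite (OmegaC (A *m lift X y)) => ->; rewrite opprK.
Qed.

Hypothesis lift_at_surj : forall y v, D y -> horizontal A (s y) v ->
  exists w, v = lift_at y w.

Lemma Ck_vcst k (w : 'cV[R]_m) : Ck k D (fun=> w : 'cV[R]_m).
Proof. exact: Ck_cst. Qed.

(** With [u = accel y], the choice of [u] for [W] and [X] and of [v] for [Y] and
    [Z] annihilates all terms but multiples of [u]: the defect is
    [8 * Omega u v ^+ 2 *: u].  Hence [u] is orthogonal to the horizontal space,
    and to everything since it is itself horizontal. *)
Lemma symmetric_accel_eq0 y : D y ->
  (forall W X Y Z, smooth W -> smooth X -> smooth Y -> smooth Z ->
    cov_curvature nabla W X Y Z y = 0) ->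
  accel y = 0.
Proof.
move=> Dy H0.
have [hs hAs] := proj_horizontal (A *m (A *m s y)) Dy.
have [wu uE] := lift_at_surj Dy (conj hs hAs).
rewrite -/(accel y) in hs hAs uE.
have [//|u0] := eqVneq (accel y) 0.
exfalso; move/eqP: u0; apply; apply: Omega_nondegenerate => v.
rewrite -(Omega_proj _ hs hAs).
have [w vE] := lift_at_surj Dy (proj_horizontal v Dy).
rewrite vE.
have CU k := Ck_vcst k wu; have CV k := Ck_vcst k w.
have H := lift_cov_curvature CU CU CV CV Dy.
rewrite /lift H0 // in H.
have L0 : lift_at y 0 = 0 by have := lift_atB y 0 0; rewrite subr0 subrr.
rewrite L0 /curvature_defect /accel_term !accel_formE // in H.
have lu : lift (fun=> wu) y = accel y by rewrite uE.
have lv : lift (fun=> w) y = lift_at y w by [].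
rewrite lu lv Omega_self in H.
move: H; set k := Omega _ _; rewrite Omega_self => H.
have {}H : 0 = (8 * k ^+ 2) *: accel y.
  rewrite [LHS]H; generalize (accel y) (lift_at y w) => a b.
  vector_ring.
have [//|k0] := eqVneq k 0.
have : accel y = 0.
  apply/eqP; move/esym/eqP: H; rewrite scaler_eq0 mulf_eq0 pnatr_eq0 /=.
  by rewrite sqrf_eq0 (negbTE k0).
by rewrite /k => ->; rewrite -[0 : 'cV_(p+p)](scale0r 0) OmegaZl mul0r.
Qed.

(** No component along [A s] appears: [Omega (A^2 s) s = - Omega (A s) (A s) = 0]. *)
Lemma accel_eq0_eigen y : accel y = 0 ->
  A *m (A *m s y) = Omega (A *m (A *m s y)) (A *m s y) *: s y.
Proof.
rewrite /accel /proj.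
have -> : Omega (A *m (A *m s y)) (s y) = 0.
  by have := in_spE (A *m s y) (s y) Asp; rewrite Omega_self => H; lra.
by rewrite scale0r addr0 => /subr0_eq.
Qed.

Lemma accel_eq0_symmetric W X Y Z y :
  smooth W -> smooth X -> smooth Y -> smooth Z ->
  D y -> accel y = 0 -> (forall w, lift_at y w = 0 -> w = 0) ->
  cov_curvature nabla W X Y Z y = 0.
Proof.
move=> CW CX CY CZ Dy a0 inj; apply: inj.
rewrite -/(lift _ y) lift_cov_curvature // /curvature_defect /accel_term.
rewrite !accel_formE // a0.
have O0 v : Omega (0 : 'cV[R]_(p + p)) v = 0.
  by rewrite -[0 : 'cV_(p+p)](scale0r 0) OmegaZl mul0r.
by rewrite !O0 !(mulr0, scaler0, scale0r, addr0, oppr0).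
Qed.

End Reduction.

(** * The chart *)

Section OpenSets.
Context {R : realType}.
Implicit Types V W : normedModType R.

Lemma open_setX V W (S : set V) (T : set W) : open S -> open T -> open (S `*` T).
Proof.
rewrite !openE => oS oT [x y] [/= Sx Ty].
by exists (S, T) => //=; split; [exact: oS|exact: oT].
Qed.

Lemma open_preimage V W (O : set V) (T : set W) (f : V -> W) :
  open O -> open T -> (forall x, O x -> {for x, continuous f}) ->
  open (O `&` f @^-1` T).
Proof.
move=> oO oT cf; rewrite openE => x [Ox Tfx].
apply: filterI; first exact: open_nbhs_nbhs.
by apply: (cf x Ox); exact: open_nbhs_nbhs.
Qed.

Lemma eball_open m (r : R) : open (eball r : set 'cV[R]_m).
Proof.
have D (y : 'cV[R]_m) : is_diff y (fun y : 'cV[R]_m => \sum_i y i 0 *: y i 0)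
    (fun v => \sum_i (y i 0 *: v i 0 + v i 0 *: y i 0)).
  apply: is_diff_sum => i.
  exact: (is_diff_scale (is_diff_coord i (is_diff_id y)) (is_diff_coord i (is_diff_id y))).
rewrite (_ : eball r = setT `&` (fun y : 'cV[R]_m => \sum_i y i 0 *: y i 0) @^-1` [set t | t < r ^+ 2]).
  apply: open_preimage; [exact: openT|exact: open_lt|].
  by move=> y _; apply: differentiable_continuous; have [] := D y.
apply/seteqP; split=> y /=; rewrite /eball /=.
  by move=> H; split=> //; under eq_bigr do rewrite -[_ *: _]/(_ * _) -expr2.
by move=> [_]; under eq_bigr do rewrite -[_ *: _]/(_ * _) -expr2.
Qed.

End OpenSets.

(** The derivative in [t] vanishes since [A] is skew for [Omega]. *)
Lemma Omega_mexp (R : realType) (p : nat) (A : 'M[R]_(p + p)) (t : R)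
    (v w : 'cV[R]_(p + p)) : in_sp A ->
  Omega (mexp (t *: A) *m v) (mexp (t *: A) *m w) = Omega v w.
Proof.
move=> Asp; pose f t := Omega (mexp (t *: A) *m v) (mexp (t *: A) *m w).
have Df x : is_derive x (1 : R) f 0.
  have H := is_diff_Omega (is_diff_mexp A x v) (is_diff_mexp A x w).
  have := is_derive_diff H; rewrite !scale1r.
  rewrite !(mulmxA _ A) -!(mexp_comm A) -!mulmxA (in_spE (mexp (x *: A) *m v)) //.
  by rewrite subrr.
have := is_derive_0_is_cst t 0 Df; rewrite /f mexp0 !mul1mx.
by [].
Qed.

Section Chart.
Context {R : realType} {n : nat}.
Variables (A : 'M[R]_(n.+1 + n.+1)) (Asp : in_sp A) (x0 : 'cV[R]_(n.+1 + n.+1)).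
Variables (U : set 'cV[R]_(n.+1 + n.+1)) (r eps : R).
Variables (chi : 'cV[R]_(n + n) * R -> 'cV[R]_(n.+1 + n.+1)).
Variables (psi : 'cV[R]_(n.+1 + n.+1) -> 'cV[R]_(n + n) * R).
Hypothesis chart : reduction_chart A x0 U r eps chi psi.
Local Notation D := (@eball R (n + n) r).
Local Notation P := (D `*` `]- eps, eps[).
Local Notation E := 'cV[R]_(n.+1 + n.+1).
Local Notation V := 'cV[R]_(n + n).
Local Notation smooth F := (forall k, Ck k D F).

Definition slice (y : V) : E := chi (y, 0).

Lemma domain_open : open P.
Proof.
apply: open_setX; [exact: eball_open|exact: interval_open].
Qed.

Lemma domain0 y : D y -> P (y, 0).
Proof.
move=> Dy; split=> //=; rewrite in_itv /= oppr_lt0 (chart_time chart).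
by [].
Qed.

Lemma Ck_chi k : Ck k P chi.
Proof.
have [sc _ _ _] := chart_diffeo chart.
by move: k; apply/(smooth_on_open _ domain_open).
Qed.

Lemma chi_mem p : P p -> U (chi p).
Proof. by have [_ _ <- _] := chart_diffeo chart => Pp; exists p. Qed.

Lemma psi_chi p : P p -> psi (chi p) = p.
Proof. by have [_ _ _ +] := chart_diffeo chart; apply. Qed.

Lemma psi_mem x : U x -> P (psi x).
Proof.
by have [_ _ <- _] := chart_diffeo chart => -[p Pp <-]; rewrite psi_chi.
Qed.

Lemma chi_psi x : U x -> chi (psi x) = x.
Proof.
by have [_ _ <- _] := chart_diffeo chart => -[p Pp <-]; rewrite psi_chi.
Qed.

Lemma U_Sigma x : U x -> Omega x (A *m x) = 1.
Proof. by have [B [_ ->]] := chart_open chart => -[]. Qed.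

Lemma chi_mexp p : P p -> chi p = mexp (p.2 *: A) *m slice p.1.
Proof.
case: p => y t [/= Dy tI]; by rewrite (chart_flow chart).
Qed.

Lemma Ck_slice k : Ck k D slice.
Proof.
have H : Ck k D (fun y : V => (y, 0 : R)).
  exact: (@Ck_affine _ _ _ _ _ _ (fun v : V => (v, 0 : R))).
exact: (Ck_comp (framed_prod (framed_cV R _) (framed_scalar R))
  (@eball_open R (n + n) r) domain0 H (Ck_chi k)).
Qed.

Lemma slice_Sigma y : D y -> Omega (slice y) (A *m slice y) = 1.
Proof. by move=> Dy; apply: U_Sigma; apply: chi_mem; exact: domain0. Qed.

Lemma near_domain p (Q : V * R -> Prop) : P p -> (forall q, P q -> Q q) ->
  \forall q \near p, Q q.
Proof.
move=> Pp PQ; near=> q; apply: PQ; near: q.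
by apply: open_nbhs_nbhs; split=> //; exact: domain_open.
Unshelve. all: by end_near. Qed.

Lemma is_diff_mexp_prod (F : V -> E) (p : V * R) (dF : V -> E) : is_diff (p.1) F dF ->
  is_diff p (fun q : V * R => mexp (q.2 *: A) *m F q.1)
    (fun w => mexp (p.2 *: A) *m (dF w.1 + w.2 *: (A *m F p.1))).
Proof.
move=> DF.
exact: (is_diff_mexp_mul A (is_diff_snd p) (is_diff_comp (is_diff_fst p) DF)).
Qed.

Lemma is_diff_chi (p : V * R) : P p ->
  is_diff p chi (fun w : V * R => mexp (p.2 *: A) *m
    ('d slice (p.1) w.1 + w.2 *: (A *m slice p.1))).
Proof.
move=> Pp; have [Dp _] := Pp.
have H := is_diff_mexp_prod (differentiableP (Ck_differentiable Ck_slice Dp)).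
apply: near_eq_is_diff H.
by apply: near_domain => // q Pq; rewrite chi_mexp.
Qed.

(** Precomposing with the chart removes the dependence on the extension: near
    [p], every extension of [f] composed with [chi] is [f \o chi]. *)
Lemma tangent_map_chi (W : normedModType R) (f : E -> W) (p w : V * R)
    (df : V * R -> W) :
  smooth_on U f -> P p -> is_diff p (f \o chi) df ->
  tangent_map U f (chi p) ('d chi p w) = df w.
Proof.
move=> sf Pp Df; rewrite /tangent_map.
set S := [set w | _].
have : S (xget 0 S).
  apply: xgetPex; have [B [F ext]] := sf _ (chi_mem Pp).
  by exists ('d F (chi p) ('d chi p w)), B, F.
case=> B [F [[oB Bx CF FE] ->]].
have dF : differentiable F (chi p) by have [dF _] := CF 1%N; exact: dF.
have dchi := differentiableP (ex_diff (is_diff_def := is_diff_chi Pp)).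
have H := is_diff_comp dchi (differentiableP dF).
have N : {near p, F \o chi =1 f \o chi}.
  near=> q; apply: FE.
    near: q; have cc : {for p, continuous chi}.
      by apply: differentiable_continuous; have [] := dchi.
    by apply: cc; exact: open_nbhs_nbhs.
  by near: q; apply: near_domain => // q; exact: chi_mem.
have H' := near_eq_is_diff N H.
rewrite -(diff_valE w Df).
by rewrite (diff_valE w H').
Unshelve. all: by end_near. Qed.

Lemma smooth_chart_proj : smooth_on U (chart_proj psi).
Proof.
have [_ sp _ _] := chart_diffeo chart => x Ux.
have [B [F [oB Bx CF FE]]] := sp x Ux.
exists B, (fst \o F); split=> // [k|z Bz Uz].
  exact: Ck_fst.
by rewrite /= FE.
Qed.

Lemma tangent_map_proj (p w : V * R) : P p ->
  tangent_map U (chart_proj psi) (chi p) ('d chi p w) = w.1.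
Proof.
move=> Pp; apply: (@tangent_map_chi _ _ _ _ fst) => //.
  exact: smooth_chart_proj.
apply: (near_eq_is_diff _ (is_diff_fst p)).
by apply: near_domain => // q Pq; rewrite /chart_proj /= psi_chi.
Qed.

(** The quadratic form [Omega z (A z)] is homogeneous, so that points near
    [Sigma A] can be rescaled onto it: the cone over [U] is a neighbourhood of
    each point of [U]. *)
Lemma normalized_line x v : U x ->
  \forall t \near (0 : R), U ((Num.sqrt (Omega (x + t *: v) (A *m (x + t *: v))))^-1
    *: (x + t *: v)) /\ 0 < Omega (x + t *: v) (A *m (x + t *: v)).
Proof.
move=> Ux; pose g (t : R) := Omega (x + t *: v) (A *m (x + t *: v)).
have Dl := is_diff_line x v 0.
have Dg := is_diff_Omega Dl (is_diff_mulmx A Dl).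
have cg : g t @[t --> 0] --> g 0.
  by apply: differentiable_continuous; have [] := Dg.
have g0 : g 0 = 1 by rewrite /g scale0r addr0; exact: U_Sigma.
have cl : (x + t *: v) @[t --> (0 : R)] --> x.
  have cl : (x + t *: v) @[t --> (0 : R)] --> x + 0 *: v.
    by have [dl _] := Dl; exact: (differentiable_continuous dl).
  by rewrite scale0r addr0 in cl.
have ck : (Num.sqrt (g t))^-1 @[t --> 0] --> (1 : R).
  have -> : 1 = (Num.sqrt (g 0))^-1 :> R by rewrite g0 sqrtr1 invr1.
  apply: cvgV; first by rewrite g0 sqrtr1 oner_eq0.
  by apply: continuous_comp cg _; exact: sqrt_continuous.
have cc : (Num.sqrt (g t))^-1 *: (x + t *: v) @[t --> 0] --> x.
  by rewrite -[X in _ --> X]scale1r; exact: cvgZ.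
have [B [oB UE]] := chart_open chart.
have Bx : B x by move: Ux; rewrite UE => -[].
have gp : \forall t \near 0, 0 < g t.
  by move: cg; rewrite g0 => /cvgr_gt; apply.
near=> t; have gt0 : 0 < g t by near: t.
split=> //; rewrite UE; split; last first.
  rewrite /Sigma /= -scalemxAr OmegaZl OmegaZr -/(g t) mulrA -expr2 exprVn.
  by rewrite sqr_sqrtr ?ltW // mulVf // gt_eqF.
near: t; apply: cc; exact: open_nbhs_nbhs.
Unshelve. all: by end_near. Qed.

(** The rescaled line [c t] through [x] lies in [U] for small [t] and has velocity
    [v] at [0], the rescaling factor being stationary there when [v] is tangent;
    differentiating [chi (psi (c t)) = c t] exhibits [v] in the image. *)
Lemma tangent_in_image x v : U x -> Omega v (A *m x) = 0 ->
  exists w, v = 'd chi (psi x) w.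
Proof.
move=> Ux vx; pose g (t : R) := Omega (x + t *: v) (A *m (x + t *: v)).
have Dl := is_diff_line x v 0.
have Dg := is_diff_Omega Dl (is_diff_mulmx A Dl).
have {}Dg : is_diff (0 : R) g (fun=> 0).
  apply: (is_diff_eq Dg); apply/funext => s; rewrite scale0r addr0.
  by rewrite -scalemxAr OmegaZl OmegaZr (in_spE x v Asp) (OmegaC (A *m x)) vx; ring.
have g0 : g 0 = 1 by rewrite /g scale0r addr0; exact: U_Sigma.
have [B [F [oB Bx CF FE]]] : exists B F, smooth_extension U psi x B F.
  by have [_ sp _ _] := chart_diffeo chart; exact: sp.
pose h (u : R) := (Num.sqrt u)^-1.
have dh : differentiable h (g 0).
  rewrite g0; apply: differentiableV; last by rewrite sqrtr1 oner_eq0.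
  apply/derivable1_diffP; have [] := is_derive1_sqrt (@ltr01 R).
  by [].
have Dk := is_diff_comp Dg (differentiableP dh).
have Dc := is_diff_scale Dk Dl.
pose c (t : R) := h (g t) *: (x + t *: v).
have {}Dc : is_diff (0 : R) c (fun s => s *: v).
  apply: (is_diff_eq Dc); apply/funext => s /=.
  by rewrite linear0 scale0r addr0 /h g0 sqrtr1 invr1 scale1r.
have c0 : c 0 = x by rewrite /c /h g0 sqrtr1 invr1 scale1r scale0r addr0.
have dF : differentiable F x by have [dF _] := CF 1%N; exact: dF.
have dF0 : differentiable F (c 0) by rewrite c0.
have Fx : F x = psi x by exact: FE.
have dchi : differentiable chi (F (c 0)).
  by rewrite c0 Fx; have [] := is_diff_chi (psi_mem Ux).
have H := is_diff_comp (is_diff_comp Dc (differentiableP dF0)) (differentiableP dchi).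
have N : {near (0 : R), chi \o (F \o c) =1 c}.
  near=> t; have [Uc _] : U (c t) /\ 0 < g t.
    by near: t; exact: normalized_line.
  rewrite /= FE ?chi_psi //; near: t.
  have cc : {for 0, continuous c} by apply: differentiable_continuous; have [] := Dc.
  by apply: cc; rewrite c0; exact: open_nbhs_nbhs.
have [_ E1] := near_eq_is_diff N H; have [_ E2] := Dc.
have /= vE := congr1 (fun f : R -> E => f 1) (etrans (esym E2) E1).
exists ('d F x v); rewrite scale1r c0 Fx in vE.
exact: vE.
Unshelve. all: by end_near. Qed.

Local Notation lf := (lift A slice).
Local Notation lf_at := (lift_at A slice).

Lemma diff_chiE (p : V * R) w c : P p ->
  'd chi p (w, c) = mexp (p.2 *: A) *m ('d slice (p.1) w + c *: (A *m slice p.1)).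
Proof. by move=> Pp; rewrite (diff_valE _ (is_diff_chi Pp)). Qed.

(** The vector on the right is horizontal because the exponentials preserve
    [Omega] and commute with [A].  A horizontal vector over [X] is the image of
    some [(X, c)] under ['d chi], and orthogonality to [x] determines [c]. *)
Lemma hlift_chi (X : vfield R (n + n)) (p : V * R) : P p ->
  hlift A U psi X (chi p) = mexp (p.2 *: A) *m lf X p.1.
Proof.
move=> Pp; have [Dp _] := Pp.
have xE := chi_mexp Pp; have Ux := chi_mem Pp.
have pE : chart_proj psi (chi p) = p.1 by rewrite /chart_proj psi_chi.
have lE : mexp (p.2 *: A) *m lf X p.1 = 'd chi p (X p.1, theta slice p.1 (X p.1)).
  by rewrite diff_chiE.
have As : A *m chi p = mexp (p.2 *: A) *m (A *m slice p.1).
  by rewrite xE !mulmxA mexp_comm.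
apply: xget_unique.
  split; last by rewrite lE tangent_map_proj // pE.
  split; rewrite ?As ?xE Omega_mexp //.
    exact: (Omega_lift_at_s slice_Sigma).
  exact: (Omega_lift_at_As (@eball_open R (n + n) r) Asp Ck_slice slice_Sigma).
move=> v [[vx vAx] tv].
have [[w c] vE] := tangent_in_image Ux vAx.
rewrite psi_chi // in vE.
have wE : w = X p.1 by move: tv; rewrite vE tangent_map_proj // pE.
rewrite lE vE wE; congr ('d chi p (_, _)).
move: vx; rewrite vE diff_chiE // xE Omega_mexp // OmegaDl OmegaZl wE.
rewrite (Omega_s_As slice_Sigma Dp) mulrN1 => /eqP; rewrite subr_eq0 => /eqP <-.
by [].
Qed.

Lemma lift_at_inj y w : D y -> lf_at y w = 0 -> w = 0.
Proof.
move=> Dy l0; have Pp := domain0 Dy.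
have H : 'd chi (y, 0) (w, theta slice y w) = 0.
  by rewrite diff_chiE //= -/(lift_at A slice y w) l0 mulmx0.
have := tangent_map_proj (w, theta slice y w) Pp; rewrite H /= => <-.
by have := tangent_map_proj 0 Pp; rewrite linear0 => ->.
Qed.

Lemma lift_at_surj y v : D y -> horizontal A (slice y) v -> exists w, v = lf_at y w.
Proof.
move=> Dy [vs vAs]; have Pp := domain0 Dy.
have [[w c] vE] := tangent_in_image (chi_mem Pp) vAs.
rewrite psi_chi // diff_chiE //= mexp0 mul1mx in vE.
exists w; rewrite vE /lift_at; congr (_ + _ *: _).
move: vs; rewrite vE OmegaDl OmegaZl (Omega_s_As slice_Sigma Dy) mulrN1.
by move=> /eqP; rewrite subr_eq0 => /eqP <-.
Qed.

(** The formula of hlift_chi extends the lift off [U], through any smooth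
    extension of [psi]. *)
Lemma smooth_hlift X : smooth X -> smooth_on U (hlift A U psi X).
Proof.
move=> CX; have [_ sp _ _] := chart_diffeo chart => x Ux.
have [B [F [oB Bx CF FE]]] := sp x Ux.
have oO : open (B `&` F @^-1` P).
  by apply: open_preimage oB domain_open _; exact: (CF 0%N).
have CF' k : Ck k (B `&` F @^-1` P) F by apply: Ck_sub (CF k) => z [].
exists (B `&` F @^-1` P), (fun z => mexp ((F z).2 *: A) *m lf X (F z).1); split=> //.
- by split=> //=; rewrite FE //; exact: psi_mem.
- move=> k; apply: (Ck_mexp_mul A oO (Ck_snd oO (CF' k))).
  apply: (@Ck_comp _ _ _ _ k _ D (fun z => (F z).1) (lf X) (framed_cV R _) oO).
  + by move=> z [_ [/=]].
  + exact: (Ck_fst oO (CF' k)).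
  + exact: (Ck_lift A (@eball_open R (n + n) r) Ck_slice k CX).
- move=> z [Bz Pz] Uz.
  by rewrite -[in RHS](chi_psi Uz) hlift_chi ?FE //; exact: psi_mem.
Qed.

Variable nabla : connection R (n + n).
Hypothesis nabla_red : reduced_connection A U D psi nabla.

Lemma Ck_nabla X Y : smooth X -> smooth Y ->
  smooth (nabla X Y).
Proof.
move=> CX CY; have oD := @eball_open R (n + n) r.
by have [/(smooth_on_open _ oD)] := nabla_red
  ((smooth_on_open X oD).2 CX) ((smooth_on_open Y oD).2 CY).
Qed.

(** At time [0], where the exponential is the identity, the derivative of
    [exp (t A) (lift Y y)] in the direction [(X, theta X)] is [cov]. *)
Lemma lift_nablaE X Y : smooth X -> smooth Y ->
  forall y, D y -> lf (nabla X Y) y = cov A slice X (lf Y) y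
    - Omega (A *m lf X y) (lf Y y) *: slice y
    + Omega (lf X y) (lf Y y) *: (A *m slice y).
Proof.
move=> CX CY y Dy; have oD := @eball_open R (n + n) r.
have [_ H] := nabla_red ((smooth_on_open X oD).2 CX) ((smooth_on_open Y oD).2 CY).
have Pp := domain0 Dy.
have {H} := H _ (chi_mem Pp); cbv zeta.
have h0 X' : hlift A U psi X' (chi (y, 0)) = lf X' y.
  by rewrite hlift_chi //= mexp0 mul1mx.
rewrite !h0 => ->; congr (_ - _ + _).
have lE : lf X y = 'd chi (y, 0) (X y, theta slice y (X y)).
  by rewrite diff_chiE //= mexp0 mul1mx.
rewrite lE.
have DY := differentiableP (Ck_differentiable (fun k => Ck_lift A oD Ck_slice k CY) Dy).
have H1 := @is_diff_mexp_prod (lf Y) (y, 0) _ DY.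
have N : {near (y, 0 : R), (fun q : V * R => mexp (q.2 *: A) *m lf Y q.1) =1
   hlift A U psi Y \o chi}.
  by apply: near_domain => // q Pq; rewrite /= hlift_chi.
rewrite (tangent_map_chi _ (smooth_hlift CY) Pp (near_eq_is_diff N H1)) /=.
by rewrite mexp0 mul1mx.
Qed.

End Chart.

(** * Locally symmetric reductions *)

(** Let [B x0 = l x0].  Comparing the eigenvector equations at [x0 + t v] and
    [x0 + 2 t v] shows that either both eigenvalues are equal, and then equal to
    [l], or [v] is a multiple of [x0]; in both cases [B v = l v]. *)
Lemma eigen_scalar (R : realType) (q : nat) (B : 'M[R]_q) (x0 : 'cV[R]_q) :
  x0 != 0 ->
  (forall v : 'cV[R]_q, \forall t \near (0 : R),
    exists a : R, B *m (x0 + t *: v) = a *: (x0 + t *: v)) ->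
  exists l : R, B = l%:M.
Proof.
move=> x00 H.
have [l Bx0] : exists l : R, B *m x0 = l *: x0.
  by have /nbhs_singleton[l] := H 0; rewrite scaler0 addr0; exists l.
exists l.
suff Bv (v : 'cV[R]_q) : B *m v = l *: v.
  apply/matrixP => i j; have := Bv (delta_mx j 0).
  by rewrite -mul_scalar_mx -!colE => /matrixP/(_ i 0); rewrite !mxE.
have /nbhs_ballP[e /= e0 He] := H v.
pose t := e / 3.
have t0 : 0 < t by rewrite divr_gt0.
have [a Ha] : exists a : R, B *m (x0 + t *: v) = a *: (x0 + t *: v).
  apply: He; rewrite /ball /= sub0r normrN gtr0_norm // /t.
  by rewrite ltr_pdivrMr // ltr_pMr // ltr1n.
have [b Hb] : exists b : R, B *m (x0 + (2 * t) *: v) = b *: (x0 + (2 * t) *: v).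
  apply: He; rewrite /ball /= sub0r normrN gtr0_norm ?mulr_gt0 // /t.
  by lra.
have alg (c : R) (u : 'cV[R]_q) :
  c *: (u - l *: v) = l *: x0 + c *: u - l *: (x0 + c *: v) by vector_ring.
have Ea : t *: (B *m v - l *: v) = (a - l) *: (x0 + t *: v).
  rewrite scalerBl -Ha mulmxDr Bx0 -scalemxAr.
  exact: alg.
have Eb : (2 * t) *: (B *m v - l *: v) = (b - l) *: (x0 + (2 * t) *: v).
  rewrite scalerBl -Hb mulmxDr Bx0 -scalemxAr.
  exact: alg.
have E : (b - l - 2 * (a - l)) *: x0 = (2 * t * (a - b)) *: v.
  have : (b - l) *: (x0 + (2 * t) *: v) = 2 *: ((a - l) *: (x0 + t *: v)).
    by rewrite -Eb -Ea scalerA.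
  move=> /eqP; rewrite -subr_eq0 => /eqP E0.
  apply/eqP; rewrite -subr_eq0; apply/eqP; rewrite -[RHS]E0.
  vector_ring.
have [ab|ab] := eqVneq a b.
  have al : a = l.
    move: E; rewrite ab subrr mulr0 scale0r => /eqP.
    by rewrite scaler_eq0 (negbTE x00) orbF => /eqP; lra.
  apply/eqP; rewrite -subr_eq0; move/eqP: Ea.
  by rewrite al subrr scale0r scaler_eq0 gt_eqF.
have k0 : 2 * t * (a - b) != 0.
  by rewrite !mulf_neq0 // ?subr_eq0 // gt_eqF.
have vE : v = ((2 * t * (a - b))^-1 * (b - l - 2 * (a - l))) *: x0.
  by rewrite -scalerA E scalerA mulVf // scale1r.
by rewrite vE -scalemxAr Bx0 !scalerA mulrC.
Qed.

Theorem lemma7p1 (R : realType) (n : nat) (hn : (2 <= n)%N)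
    (A : 'M[R]_(n.+1 + n.+1)) (A_neq0 : A != 0) (A_sp : in_sp A)
    (Sigma_neq0 : Sigma A !=set0)
    (x0 : 'cV[R]_(n.+1 + n.+1)) (Sigma_x0 : Sigma A x0)
    (U : set 'cV[R]_(n.+1 + n.+1)) (r eps : R)
    (chi : 'cV[R]_(n + n) * R -> 'cV[R]_(n.+1 + n.+1))
    (psi : 'cV[R]_(n.+1 + n.+1) -> 'cV[R]_(n + n) * R)
    (chart : reduction_chart A x0 U r eps chi psi)
    (omega : 'cV[R]_(n + n) -> 'cV[R]_(n + n) -> 'cV[R]_(n + n) -> R)
    (omega_red : reduced_form A U (eball r) psi omega)
    (nabla : connection R (n + n))
    (nabla_red : reduced_connection A U (eball r) psi nabla) :
  locally_symmetric (eball r) nabla <->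
  exists lambda : R, A ^+ 2 = lambda%:M.
Proof.
have oD := @eball_open R (n + n) r.
have Cs := Ck_slice chart.
have sS := slice_Sigma chart.
have CN := @Ck_nabla _ _ _ _ _ _ _ nabla_red.
have LN := @lift_nablaE _ _ _ A_sp _ _ _ _ _ _ chart _ nabla_red.
split=> [sym|[l Al]]; last first.
  move=> W X Y Z /(smooth_on_open _ oD) CW /(smooth_on_open _ oD) CX.
  move=> /(smooth_on_open _ oD) CY /(smooth_on_open _ oD) CZ y Dy.
  apply: (accel_eq0_symmetric oD A_sp Cs sS CN LN CW CX CY CZ Dy).
    rewrite /accel mulmxA mulmxE -expr2 Al mul_scalar_mx projZ (proj_s sS Dy).
    exact: scaler0.
  by move=> w; exact: (lift_at_inj chart Dy).
(* The flow, which commutes with [A], carries the eigenvector equation from the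
   slice to the whole of [U]. *)
have sq_eigen x : U x -> exists a : R, A ^+ 2 *m x = a *: x.
  move=> Ux; have Pp := psi_mem chart Ux; have [Dp _] := Pp.
  set y := (psi x).1 in Dp.
  have a0 : accel A (slice chi) y = 0.
    apply: (symmetric_accel_eq0 oD A_sp Cs sS CN LN (lift_at_surj A_sp chart) Dp).
    move=> W X Y Z CW CX CY CZ.
    by apply: sym => //; apply/(smooth_on_open _ oD).
  have E := accel_eq0_eigen A_sp a0.
  move: E; set a := Omega _ _ => E; exists a.
  rewrite -[in LHS](chi_psi chart Ux) -[in RHS](chi_psi chart Ux) (chi_mexp chart Pp) -/y.
  set t := (psi x).2.
  have comm w : A *m (mexp (t *: A) *m w) = mexp (t *: A) *m (A *m w).
    by rewrite !mulmxA mexp_comm.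
  by rewrite expr2 -mulmxE -mulmxA !comm E scalemxAr.
apply: (@eigen_scalar _ _ _ x0).
  apply/eqP => x00; have := Sigma_x0; rewrite /Sigma /= x00.
  rewrite -[X in Omega X](scale0r x0) OmegaZl mul0r => /eqP.
  by rewrite eq_sym oner_eq0.
move=> v; near=> t.
have [/sq_eigen[a Ha] g0] : U ((Num.sqrt (Omega (x0 + t *: v) (A *m (x0 + t *: v))))^-1
    *: (x0 + t *: v)) /\ 0 < Omega (x0 + t *: v) (A *m (x0 + t *: v)).
  by near: t; exact: (normalized_line chart v (chart_mem chart)).
exists a; move: Ha; set k := _^-1 => Ha.
have k0 : k != 0 by rewrite invr_eq0 gt_eqF // sqrtr_gt0.
apply: (scalerI k0); rewrite scalemxAr Ha !scalerA mulrC.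
by [].
Unshelve. all: by end_near. Qed.
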